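(* Let $\mathcal{P}\subset(\mathbb{C}^* )^3$ be a uniform plane, and denote the lines of the associated arrangement in $\mathbb{C}P^2$ by $\mathcal{L}_i,\mathcal{L}_j,\mathcal{L}_k,\mathcal{L}_l$. Let $\mathcal{C}_2\subset\mathcal{P}$ be the degree 2 curve finely approximating the fan tropical curve in $\operatorname{Trop}(\mathcal{P})$ with three rays of weight one in the directions $u_i+2u_k$, $u_j+2u_l$, $u_i+u_j$. Let $\mathcal{L}_m$ be the unique line passing through the two points $\mathcal{L}_i\cap\mathcal{L}_k$ and $\mathcal{L}_j\cap\mathcal{L}_l$, and let $\mathcal{L}_n$ be the unique line tangent to (the closure of) $\mathcal{C}_2$ at the point $\mathcal{L}_i\cap\mathcal{L}_j$. Then the following fan tropical curves $C\subset\operatorname{Trop}(\mathcal{P}')$ are finely approximated in the plane $\mathcal{P}'$: (1) the plane $\mathcal{P}'\subset(\mathbb{C}^* )^4$ corresponds to the arrangement of 5 lines $\mathcal{L}_i,\mathcal{L}_j,\mathcal{L}_k,\mathcal{L}_l,\mathcal{L}_m$; the three rays of $C\subset\operatorname{Trop}(\mathcal{P}')$ are of weight one with primitive integer directions $u_i+u_j$, $u_i+2u_k+u_m$, $u_j+2u_l+u_m$. (2) the plane $\mathcal{P}'\subset(\mathbb{C}^* )^4$ corresponds to the arrangement of 5 lines $\mathcal{L}_i,\mathcal{L}_j,\mathcal{L}_k,\mathcal{L}_l,\mathcal{L}_n$; the three rays of $C\subset\operatorname{Trop}(\mathcal{P}')$ are of weight one with primitive integer directions $u_i+u_j+2u_n$,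 $u_i+2u_k$, $u_j+2u_l$. (3) the plane $\mathcal{P}'\subset(\mathbb{C}^* )^5$ corresponds to the arrangement of 6 lines $\mathcal{L}_i,\mathcal{L}_j,\mathcal{L}_k,\mathcal{L}_l,\mathcal{L}_m,\mathcal{L}_n$; the three rays of $C\subset\operatorname{Trop}(\mathcal{P}')$ are of weight one with primitive integer directions $u_i+u_j+2u_n$, $u_i+2u_k+u_m$, $u_j+2u_l+u_m$.
   Context: A line arrangement $\mathcal{A}=\{\mathcal{L}_0,\dots,\mathcal{L}_N\}$ in $\mathbb{C}P^2$ with $\bigcap_i\mathcal{L}_i=\emptyset$ defines an embedding $\mathbb{C}P^2\to\mathbb{C}P^N$, $z\mapsto[f_0(z):\dots:f_N(z)]$, with $f_r$ a linear form defining $\mathcal{L}_r$; the corresponding plane is the image of $\mathbb{C}P^2\setminus\mathcal{A}$ in $(\mathbb{C}^* )^N=\mathbb{C}P^N\setminus\{\text{coordinate hyperplanes}\}$. The plane is uniform if no three lines of $\mathcal{A}$ are concurrent. To the line $\mathcal{L}_r$ corresponds the vector $u_r\in\mathbb{Z}^N$, the primitive outward normal to the facet of the standard simplex corresponding to the coordinate hyperplane containing $\mathcal{L}_r$ (for $\mathcal{L}_r=\{z_r=0\}$, $r\ge1$, in the affine chart $z_0=1$: $u_r=-e_r$, and $u_0=e_1+\dots+e_N$), so $\sum_ru_r=0$. $\operatorname{Trop}(\mathcal{X})=\lim_{t\to\infty}\mathrm{Log}_t(\mathcal{X})$, $\mathrm{Log}_t(z_r)=(\log|z_r|/\log t)$;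 for a curve $\mathcal{C}$ an edge $e$ has weight equal to the sum of the intersection multiplicities of the closure of $\mathcal{C}$ with the toric divisor corresponding to $e$, in a toric compactification where this closure meets no intersection of two toric divisors. A fan tropical curve is a 1-dimensional rational fan with positive integer weights satisfying the balancing condition (sum of weights times outgoing primitive directions is 0). $C\subset\operatorname{Trop}(\mathcal{P}')$ is finely approximable in $\mathcal{P}'$ if there is an irreducible and reduced curve $\mathcal{C}\subset\mathcal{P}'$ with $\operatorname{Trop}(\mathcal{C})=C$. The curve $\mathcal{C}_2$ exists and is unique: its closure is the conic tangent to $\mathcal{L}_k$ at $\mathcal{L}_i\cap\mathcal{L}_k$, tangent to $\mathcal{L}_l$ at $\mathcal{L}_j\cap\mathcal{L}_l$, and passing through $\mathcal{L}_i\cap\mathcal{L}_j$. *)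

(* Defs.v *)
From HB Require Import structures.
From mathcomp Require Import all_boot all_order all_algebra.
From mathcomp Require Import complex.
From mathcomp Require Import classical_sets reals topology normedtype exp.
(* The notations of mpoly clash with those of MathComp-Analysis. *)
From mathcomp Require Export -(notations) mpoly.

Set Implicit Arguments.
Unset Strict Implicit.
Unset Printing Implicit Defensive.

Import Order.TTheory GRing.Theory Num.Theory numFieldNormedType.Exports.

Local Open Scope classical_set_scope.
Local Open Scope ring_scope.

Local Notation "x %:F" := (FracField.tofrac x).

Section LineArrangements.
Variables (R : realType) (N : nat).
Local Notation C := R[i].

(* Points of CP^2 are given by homogeneous coordinates z : 'rV[C]_3, z != 0,
   linear forms by their coefficient vectors. *)
Definition lform (a z : 'rV[C]_3) : C := (a *m z^T) 0 0.

Definition proj_line (a : 'rV[C]_3) : set 'rV[C]_3 :=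
  [set z | z != 0 /\ lform a z = 0].

Definition line_arrangement (f : 'I_N.+1 -> 'rV[C]_3) : Prop :=
  [/\ forall r, f r != 0,
      injective (fun r => proj_line (f r)) &
      \bigcap_r proj_line (f r) = set0].

Definition uniform (f : 'I_N.+1 -> 'rV[C]_3) : Prop :=
  forall r s t, uniq [:: r; s; t] ->
    proj_line (f r) `&` proj_line (f s) `&` proj_line (f t) = set0.

(* The torus (C^* )^N is the chart z_0 = 1 of CP^N minus the coordinate
   hyperplanes: its coordinates are f_r / f_0 for r = 1, ..., N. *)
Definition to_torus (f : 'I_N.+1 -> 'rV[C]_3) (z : 'rV[C]_3) : 'rV[C]_N :=
  \row_(a < N) (lform (f (lift ord0 a)) z / lform (f ord0) z).

Definition off_lines (f : 'I_N.+1 -> 'rV[C]_3) : set 'rV[C]_3 :=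
  [set z | forall r, lform (f r) z != 0].

Definition plane (f : 'I_N.+1 -> 'rV[C]_3) : set 'rV[C]_N :=
  to_torus f @` off_lines f.

(* The curve in the plane whose closure in CP^2 is {F = 0}. *)
Definition plane_curve (f : 'I_N.+1 -> 'rV[C]_3) (F : mpoly 3 C) :
    set 'rV[C]_N :=
  to_torus f @` (off_lines f `&` [set z | meval (z 0) F = 0]).

(* u_0 = e_1 + ... + e_N and u_r = - e_r for r >= 1. *)
Definition uvec (r : 'I_N.+1) : 'rV[int]_N :=
  if unlift ord0 r is Some a then - delta_mx 0 a else const_mx 1.

End LineArrangements.

Section PlaneCurves.
Variable R : realType.
Local Notation C := R[i].

Definition irreducible_mpoly n (F : mpoly n C) : Prop :=
  [/\ F != 0, F \isn't a GRing.unit &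
      forall G H : mpoly n C, F = G * H ->
        G \is a GRing.unit \/ H \is a GRing.unit].

(* The line {a = 0} passes through the point p of {F = 0} and is contained in
   the projective Zariski tangent space of {F = 0} at p. *)
Definition tangent_line (F : mpoly 3 C) (a p : 'rV[C]_3) : Prop :=
  [/\ a != 0, meval (p 0) F = 0, proj_line a p &
      forall z, proj_line a z ->
        \sum_(c < 3) meval (p 0) (mderiv c F) * z 0 c = 0].

End PlaneCurves.

Section LogLimit.
Variables (R : realType) (N : nat).
Local Notation C := R[i].

Definition Log (t : R) (z : 'rV[C]_N) : 'rV[R]_N :=
  \row_(a < N) (ln (ComplexField.Normc.normc (z 0 a)) / ln t).

Definition Log_liminf (X : set 'rV[C]_N) : set 'rV[R]_N :=
  [set x | forall U, nbhs x U ->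
     \forall t \near +oo, (Log t @` X) `&` U !=set0].

Definition Log_limsup (X : set 'rV[C]_N) : set 'rV[R]_N :=
  [set x | forall U, nbhs x U ->
     forall t0 : R, exists2 t, t0 < t & (Log t @` X) `&` U !=set0].

(* Log_t(X) --> T as t --> +oo in the Painleve-Kuratowski sense, i.e. in the
   Hausdorff sense on compact sets. *)
Definition Log_cvg (X : set 'rV[C]_N) (T : set 'rV[R]_N) : Prop :=
  Log_liminf X = T /\ Log_limsup X = T.

(* Like lim, Trop X has its intended meaning when the limit exists, which is
   always the case for an algebraic subvariety X of the torus. *)
Definition Trop (X : set 'rV[C]_N) : set 'rV[R]_N := Log_liminf X.

End LogLimit.

Section IntersectionMultiplicity.
Variables (R : realType) (N : nat).
Local Notation C := R[i].
Local Notation K := {fraction mpoly N C}.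

Definition vanishes_on (Y : set 'rV[C]_N) (g : mpoly N C) : Prop :=
  forall y, Y y -> meval (y 0) g = 0.

Definition zariski_closure (Y : set 'rV[C]_N) : set 'rV[C]_N :=
  [set p | forall g, vanishes_on Y g -> meval (p 0) g = 0].

(* The local ring of C^N at p. *)
Definition local_ring (p : 'rV[C]_N) : set K :=
  [set x | exists g h : mpoly N C, meval (p 0) h != 0 /\ x = g%:F / h%:F].

(* The ideal of the local ring at p generated by the ideal of the closure of Y
   and by the coordinate y_a. *)
Definition local_ideal (Y : set 'rV[C]_N) (a : 'I_N) (p : 'rV[C]_N) : set K :=
  [set x | exists g q h : mpoly N C,
     [/\ vanishes_on Y g, meval (p 0) h != 0 &
         x = (g + mpolyX C (mnm1 a) * q)%:F / h%:F]].

(* The intersection multiplicity at p of the closure of Y with {y_a = 0}, i.e.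
   the dimension over C of the local ring modulo the above ideal, is d. *)
Definition intersection_mult (Y : set 'rV[C]_N) (a : 'I_N) (p : 'rV[C]_N)
    (d : nat) : Prop :=
  exists e : 'I_d -> K,
    (forall b, local_ring p (e b)) /\
    (forall x, local_ring p x -> exists! c : 'rV[C]_d,
       local_ideal Y a p (x - \sum_(b < d) (mpolyC N (c 0 b))%:F * e b)).

(* The open torus orbit of the divisor {y_a = 0} in C x (C^* )^(N-1). *)
Definition divisor_orbit (a : 'I_N) : set 'rV[C]_N :=
  [set p | forall b, (p 0 b == 0) = (b == a)].

Definition divisor_intersection (Y : set 'rV[C]_N) (a : 'I_N) (w : nat) :
    Prop :=
  exists (s : seq 'rV[C]_N) (mu : 'rV[C]_N -> nat),
    [/\ uniq s,
        [set` s] = zariski_closure Y `&` divisor_orbit a,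
        forall p, p \in s -> intersection_mult Y a p (mu p) &
        w = (\sum_(p <- s) mu p)%N].

Definition monomial_map (A : 'M[int]_N) (z : 'rV[C]_N) : 'rV[C]_N :=
  \row_(b < N) \prod_(c < N) z 0 c ^ A b c.

(* In any toric compactification having the ray u as an edge, the torus and the
   open orbit of the divisor D_u form the chart C x (C^* )^(N-1) in which D_u is
   {y_a = 0}, where the y_b are the monomials of a unimodular A with
   A u = - e_a: since u is an outward normal, y_a tends to 0 along u.  When the
   closure of X meets no intersection of two toric divisors, it meets D_u only
   in this chart. *)
Definition edge_weight (X : set 'rV[C]_N) (u : 'rV[int]_N) (w : nat) : Prop :=
  exists (A : 'M[int]_N) (a : 'I_N),
    [/\ A \in unitmx, A *m u^T = - delta_mx a 0 &
        divisor_intersection (monomial_map A @` X) a w].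

End IntersectionMultiplicity.

Section FanTropicalCurves.
Variables (R : realType) (N : nat).
Local Notation C := R[i].

Definition primitive (u : 'rV[int]_N) : bool :=
  (\big[gcdn/0]_(a < N) `|u 0%R a|)%N == 1%N.

(* A weighted fan of dimension 1 is given by the list of its rays: outgoing
   primitive direction and weight. *)
Definition fan_tropical_curve (s : seq ('rV[int]_N * nat)) : Prop :=
  [/\ s != [::], uniq [seq e.1 | e <- s],
      forall e, e \in s -> primitive e.1 /\ (0 < e.2)%N &
      \sum_(e <- s) e.1 *+ e.2 = 0].

Definition support (s : seq ('rV[int]_N * nat)) : set 'rV[R]_N :=
  [set x | exists e, exists lam : R,
     [/\ e \in s, 0 <= lam & x = lam *: map_mx intr e.1]].

(* Trop X = s as weighted fans. *)
Definition trop_curve (X : set 'rV[C]_N) (s : seq ('rV[int]_N * nat)) : Prop :=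
  Log_cvg X (support s) /\ (forall e, e \in s -> edge_weight X e.1 e.2).

(* The irreducible and reduced curve of degree d in the plane of f whose closure
   is {F = 0} finely approximates the fan tropical curve s. *)
Definition finely_approximates (f : 'I_N.+1 -> 'rV[C]_3) (d : nat)
    (F : mpoly 3 C) (s : seq ('rV[int]_N * nat)) : Prop :=
  [/\ fan_tropical_curve s,
      support s `<=` Trop (plane f),
      F \is ishomog1 d mdeg /\ irreducible_mpoly F,
      plane_curve f F !=set0 &
      trop_curve (plane_curve f F) s].

Definition finely_approximable (f : 'I_N.+1 -> 'rV[C]_3)
    (s : seq ('rV[int]_N * nat)) : Prop :=
  exists d F, finely_approximates f d F s.

End FanTropicalCurves.

Arguments support R {N} s.

(* Main.v *)
Require Import Defs.
From HB Require Import structures.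
From mathcomp Require Import all_boot all_order all_algebra.
From mathcomp Require Import complex.
From mathcomp Require Import classical_sets reals.
From mathcomp Require Import boolp topology normedtype sequences exp.
From mathcomp Require Import ring lra zify.

(** The closure of the given curve C_2 is a conic tangent to the line k at the
    point (i, k), tangent to the line l at the point (j, l), and passing through
    the point (i, j).  Parametrize it by [s : t] so that these three points have
    the parameters s = 0, t = 0 and s = t.  Restricted to the conic, the
    equations of the lines become, up to constants,

      f_i = s (s - t),   f_j = t (s - t),   f_k = s^2,   f_l = t^2,

    and the added lines are just those whose equations are again monomials in
    s, t and s - t: f_m = s t for the chord through the first two points, and
    f_n = (s - t)^2 for the tangent at the third.  Adding them to the
    arrangement removes no further points from the conic, and in each of the
    new planes the conic is the curve with coordinates
    kappa_b s^alpha_b (s - 1)^beta_b, for s different from 0 and 1.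

    The tropicalization of such a curve is the image of the tropical line under
    the linear map with matrix (alpha, beta): by the triangle inequality
    (ln |s|, ln |s - 1|) stays at bounded distance from the tropical line and
    comes near each of its points (mono_curve_Log_cvg), and bounded distances
    disappear in the limit (Log_cvg_close).  The rays are thus the sums of the
    u_r with the vanishing orders of f_r at the three points as coefficients.
    Their weights are 1: the exponents of i, j and one further line make a minor
    of (alpha, beta) equal to 1 or -1 (minor2_ray), hence after a monomial
    change of coordinates (unimodular_straighten) the curve is an affine line
    transversal to the relevant divisor (line_intersection_mult).

    It remains to recover the conic from the hypothesis on its tropicalization.
    Since the limit contains the ray u_i + 2 u_k, there are points of the curve
    at which f_k is negligible against f_i, and f_i against f_j
    (ray_dominance); letting the ratios tend to zero in the equation kills two
    coefficients.  The three rays together determine the equation up to a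
    factor (conic_equation). *)

Set Implicit Arguments.
Unset Strict Implicit.
Unset Printing Implicit Defensive.
Import Order.TTheory GRing.Theory Num.Theory numFieldNormedType.Exports.
Local Open Scope classical_set_scope.
Local Open Scope ring_scope.

(** * Logarithmic limits of sets close to a cone *)

Section CoarseLimits.
Variables (R : realType) (N : nat).
Local Notation C := R[i].
Local Notation normc := (@ComplexField.Normc.normc R).

Lemma row_ballP (x y : 'rV[R]_N) e : 0 < e ->
  ball x e y <-> forall b, `|x 0 b - y 0 b| < e.
Proof.
move=> e0; split=> [[_ H] b|H]; first exact: H.
by split=> // i b; rewrite ord1; exact: H.
Qed.

Definition log_row (z : 'rV[C]_N) : 'rV[R]_N := \row_b ln (normc (z 0 b)).

Definition sup_close (K : R) (x y : 'rV[R]_N) := forall b, `|x 0 b - y 0 b| <= K.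

Lemma Log_scale t z b : Log t z 0 b = log_row z 0 b / ln t.
Proof. by rewrite !mxE. Qed.

Lemma ln_large (K e t : R) : 0 <= K -> 0 < e -> expR (K / e) < t ->
  0 < ln t /\ K / ln t < e.
Proof.
move=> K0 e0 ht.
have t0 : 0 < t by apply: lt_trans ht; exact: expR_gt0.
have lt : K / e < ln t by rewrite -(expRK (K / e)) ltr_ln ?posrE ?expR_gt0.
have l0 : 0 < ln t by apply: le_lt_trans lt; rewrite divr_ge0 // ltW.
by split=> //; rewrite ltr_pdivrMr // mulrC -ltr_pdivrMr.
Qed.

Lemma Log_liminf_sub_limsup (X : set 'rV[C]_N) : Log_liminf X `<=` Log_limsup X.
Proof.
move=> x hx U /hx hU t0.
by have [t] := pinfty_ex_gt (num_real t0) hU; exists t.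
Qed.

(** Dividing by ln t shrinks a bounded error to zero and preserves a cone.  Hence
    the logarithmic limit of a set whose logarithmic image is at bounded
    Hausdorff distance from a closed cone is that cone: all estimates below can
    ignore multiplicative constants and need not mention t. *)
Lemma Log_cvg_close (X : set 'rV[C]_N) (S : set 'rV[R]_N) (K : R) :
  0 <= K -> closed S ->
  (forall (lam : R) y, 0 <= lam -> S y -> S (lam *: y)) ->
  (forall z, X z -> exists2 y, S y & sup_close K (log_row z) y) ->
  (forall y, S y -> exists2 z, X z & sup_close K (log_row z) y) ->
  Log_cvg X S.
Proof.
move=> K0 clS coneS XS SX.
have inf : S `<=` Log_liminf X.
  move=> x Sx U /nbhs_ballP [e /= e0 eU].
  near=> t.
  have [l0 ke] : 0 < ln t /\ K / ln t < e.
    by apply: ln_large => //; near: t; apply: nbhs_pinfty_gt; exact: num_real.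
  have [z Xz zx] := SX _ (coneS _ _ (ltW l0) Sx).
  exists (Log t z); split; first by exists z.
  apply: eU; apply/row_ballP => // b.
  rewrite Log_scale; apply: le_lt_trans ke.
  rewrite ler_pdivlMr // -[X in _ * X]gtr0_norm // -normrM mulrBl divfK ?gt_eqF //.
  by have := zx b; rewrite !mxE distrC mulrC.
have sup : Log_limsup X `<=` S.
  move=> x hx; apply: clS => U /nbhs_ballP [e /= e0 eU].
  have e20 : 0 < e / 2 by rewrite divr_gt0.
  have [t tK [_ [[z Xz <-] bz]]] :=
    hx _ (nbhsx_ballx x _ e20) (expR (K / (e / 2))).
  have [l0 ke] := ln_large K0 e20 tK.
  have [y Sy zy] := XS _ Xz.
  exists ((ln t)^-1 *: y); split; first by apply: coneS; rewrite // invr_ge0 ltW.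
  apply: eU; rewrite [e]splitr; apply: ball_triangle bz _.
  apply/row_ballP => // b; apply: le_lt_trans ke.
  rewrite Log_scale [(_ *: y) 0 b]mxE [_ * y 0 b]mulrC -mulrBl normrM ler_pM //.
  by rewrite gtr0_norm ?invr_gt0.
have lis := @Log_liminf_sub_limsup X.
by split; apply/seteqP; split=> // x; [move=> /lis /sup | move=> /inf /lis].
Unshelve. all: by end_near.
Qed.

End CoarseLimits.

Section Rays.
Variables (R : realType) (N : nat).

(** Membership in a ray is a closed condition on coordinates: the multiplier can
    be read off continuously from one nonzero coordinate of v. *)
Lemma closed_ray (v : 'rV[R]_N) : v != 0 ->
  closed [set x | exists2 lam : R, 0 <= lam & x = lam *: v].
Proof.
move=> v0.
have [b vb] : exists b, v 0 b != 0 by apply/rV0Pn.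
have coordC c := @coord_continuous R 1 N 0 c.
pose lam (x : 'rV[R]_N) := x 0 b / v 0 b.
have lamC : continuous lam.
  by move=> x; exact: (cvgM (coordC b x) (cvg_cst _)).
suff -> : [set x | exists2 lam : R, 0 <= lam & x = lam *: v] =
   (lam @^-1` [set y | 0 <= y]) `&`
   \bigcap_c ((fun x : 'rV[R]_N => x 0 c - lam x * v 0 c) @^-1` [set y | y = 0]).
  apply: closedI; first by apply: closed_comp => [x _|]; [exact: lamC|exact: closed_ge].
  apply: closed_bigI => c _; apply: closed_comp; last exact: closed_eq.
  by move=> x _; exact: (cvgB (coordC c x) (cvgM (lamC x) (cvg_cst _))).
apply/seteqP; split=> [x [l l0 ->]|x [/= l0 h]].
  have ll : lam (l *: v) = l by rewrite /lam mxE mulfK.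
  by split; rewrite /= ?ll // => c _ /=; rewrite ll mxE subrr.
exists (lam x) => //; apply/rowP => c; rewrite mxE.
by apply/eqP; rewrite -subr_eq0; apply/eqP; exact: h.
Qed.

Lemma closed_support (s : seq ('rV[int]_N * nat)) :
  (forall e, e \in s -> e.1 != 0) -> closed (Defs.support R s).
Proof.
elim: s => [|e s IH] hs.
  rewrite (_ : Defs.support R [::] = set0); first exact: closed0.
  by apply/seteqP; split=> // x [e [lam []]].
rewrite (_ : Defs.support R (e :: s) =
  [set x | exists2 lam : R, 0 <= lam & x = lam *: map_mx intr e.1] `|` Defs.support R s).
  apply: closedU; last by apply: IH => e' se'; apply: hs; rewrite inE se' orbT.
  apply: closed_ray; have := hs e (mem_head _ _); apply: contraNneq => h.
  apply/eqP/rowP => b; have /rowP/(_ b)/eqP := h.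
  by rewrite !mxE intr_eq0 => /eqP.
apply/seteqP; split=> x.
  move=> [e' [lam [+ l0 ->]]]; rewrite inE => /predU1P[->|es]; first by left; exists lam.
  by right; exists e', lam.
move=> [[lam l0 ->]|[e' [lam [es l0 ->]]]]; first by exists e, lam; rewrite mem_head.
by exists e', lam; rewrite inE es orbT.
Qed.

Lemma support_scale (s : seq ('rV[int]_N * nat)) (lam : R) y :
  0 <= lam -> Defs.support R s y -> Defs.support R s (lam *: y).
Proof.
move=> l0 [e [mu [es m0 ->]]]; exists e, (lam * mu).
by rewrite mulr_ge0 // scalerA.
Qed.

End Rays.

(** * The tropical line and monomial curves *)

Section TropicalLine.
Variable R : realType.
Implicit Types p q x y : R.

(** The logarithmic limit of the line {(s, s - 1)}: the three rays correspond to
    s tending to 0, to 1 and to infinity. *)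
Definition tropical_line x y := exists2 lam : R, 0 <= lam &
  [\/ x = - lam /\ y = 0, x = 0 /\ y = - lam | x = lam /\ y = lam].

Lemma ln_close p q : 0 < p -> 0 < q -> p <= 2 * q -> q <= 2 * p ->
  `|ln p - ln q| <= ln 2.
Proof.
move=> p0 q0 pq qp.
have H (a b : R) : 0 < a -> 0 < b -> a <= 2 * b -> ln a <= ln 2 + ln b.
  by move=> a0 b0 ab; rewrite -lnM ?posrE // ler_ln ?posrE // mulr_gt0.
have := H _ _ p0 q0 pq; have := H _ _ q0 p0 qp; rewrite ler_norml; lra.
Qed.

(** The three hypotheses on p and q are the triangle inequalities between |s|,
    |s - 1| and 1.  They force the two largest of these numbers to be within a
    factor 2 of each other, which bounds the distance to the ray on which the
    corresponding two tropical coordinates agree. *)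
Lemma ln_pair_near_tropical_line p q : 0 < p -> 0 < q ->
  q <= p + 1 -> p <= q + 1 -> 1 <= p + q ->
  exists x y, [/\ tropical_line x y, `|ln p - x| <= ln 2 & `|ln q - y| <= ln 2].
Proof.
move=> p0 q0 qp pq pq1.
have ln20 : (0 : R) <= ln 2 by apply: ln_ge0; lra.
have [[p1 pleq]|[[q1 qlep]|[p1 q1]]] :
    (p <= 1 /\ p <= q) \/ (q <= 1 /\ q <= p) \/ (1 <= p /\ 1 <= q).
  by have [] := leP p 1; have [] := leP q 1; have [] := leP p q; lra.
- exists (ln p), 0; split; last by rewrite -ln1 ln_close //; lra.
    by exists (- ln p); [rewrite oppr_ge0 ln_le0 | constructor 1; rewrite opprK].
  by rewrite subrr normr0.
- exists 0, (ln q); split; first last.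
  + by rewrite subrr normr0.
  + by rewrite -ln1 ln_close //; lra.
  by exists (- ln q); [rewrite oppr_ge0 ln_le0 | constructor 2; rewrite opprK].
- exists (ln p), (ln p); split; last by rewrite ln_close //; lra.
    by exists (ln p); [rewrite ln_ge0 | constructor 3].
  by rewrite subrr normr0.
Qed.

(** Real parameters suffice: exp(-lam)/2, 1 - exp(-lam)/2 and 2 exp(lam) go to
    0, 1 and infinity; the factors 2 keep them away from the other two
    punctures, even for lam = 0. *)
Lemma tropical_line_near_ln_pair x y : tropical_line x y ->
  exists r : R, [/\ 0 < `|r|, 0 < `|r - 1|,
    `|ln `|r| - x| <= ln 2 & `|ln `|r - 1| - y| <= ln 2].
Proof.
move=> [lam l0 h].
have ln20 : (0 : R) <= ln 2 by apply: ln_ge0; lra.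
have e0 := expR_gt0 (- lam); have e1 : expR (- lam) <= 1 by rewrite -expR0 ler_expR; lra.
have f1 : 1 <= expR lam by rewrite -expR0 ler_expR; lra.
have lnE (m r : R) : 0 < r -> r <= 2 * expR m -> expR m <= 2 * r -> `|ln r - m| <= ln 2.
  by move=> r0 h1 h2; rewrite -[m]expRK ln_close // expR_gt0.
have ln1E (r : R) : 0 < r -> r <= 2 -> 1 <= 2 * r -> `|ln r - 0| <= ln 2.
  by move=> r0 h1 h2; apply: lnE; rewrite ?expR0 //; lra.
case: h => -[-> ->].
- exists (expR (- lam) / 2); rewrite ger0_norm; last by lra.
  rewrite ler0_norm; last by lra.
  by split; [lra|lra|apply: lnE; lra|apply: ln1E; lra].
- exists (1 - expR (- lam) / 2); rewrite [1 - _ - 1]addrAC subrr add0r normrN.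
  rewrite (ger0_norm (_ : 0 <= 1 - expR (- lam) / 2)); last by lra.
  rewrite (ger0_norm (_ : 0 <= expR (- lam) / 2)); last by lra.
  by split; [lra|lra|apply: ln1E; lra|apply: lnE; lra].
- exists (2 * expR lam); rewrite (ger0_norm (_ : 0 <= 2 * expR lam)); last by lra.
  rewrite (ger0_norm (_ : 0 <= 2 * expR lam - 1)); last by lra.
  by split; [lra|lra|apply: lnE; lra|apply: lnE; lra].
Qed.

End TropicalLine.

Section MonomialCurve.
Variables (R : realType) (N : nat).
Local Notation C := R[i].
Local Notation normc := (@ComplexField.Normc.normc R).
Implicit Types (kappa : 'rV[C]_N) (alpha beta : 'rV[int]_N).

Definition mono_pt kappa alpha beta (s : C) : 'rV[C]_N :=
  \row_b (kappa 0 b * s ^ alpha 0 b * (s - 1) ^ beta 0 b).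

(** The image of the projective line punctured at 0, 1 and infinity under a
    translated monomial map.  A conic on which every line of an arrangement
    cuts out a divisor supported at three fixed points is such a curve. *)
Definition mono_curve kappa alpha beta : set 'rV[C]_N :=
  [set mono_pt kappa alpha beta s | s in [set s | s != 0 /\ s != 1]].

Lemma normc_ge0 (z : C) : 0 <= normc z.
Proof. by case: z => a b; exact: sqrtr_ge0. Qed.

Lemma normc_gt0 (z : C) : (0 < normc z) = (z != 0).
Proof.
rewrite lt_def normc_ge0 andbT; apply/negb_inj; rewrite !negbK.
apply/eqP/eqP => [/Normc.eq0_normc //|->].
exact: Normc.normc0.
Qed.

Lemma normc_real (r : R) : normc (r%:C)%C = `|r|.
Proof. by rewrite /normc /= expr0n addr0 sqrtr_sqr. Qed.

Lemma normc_add (z w : C) : normc (z + w) <= normc z + normc w.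
Proof. exact: le_normcD. Qed.

Lemma normc_opp (z : C) : normc (- z) = normc z.
Proof. exact: normcN. Qed.

Lemma ln_normcM (z w : C) : z != 0 -> w != 0 ->
  ln (normc (z * w)) = ln (normc z) + ln (normc w).
Proof. by move=> z0 w0; rewrite Normc.normcM lnM // posrE normc_gt0. Qed.

Lemma ln_normcX (z : C) (n : int) : z != 0 ->
  ln (normc (z ^ n)) = n%:~R * ln (normc z).
Proof.
move=> z0.
have H (m : nat) : ln (normc (z ^+ m)) = m%:R * ln (normc z).
  elim: m => [|m IH]; first by rewrite expr0 Normc.normc1 ln1 mul0r.
  by rewrite exprS ln_normcM ?expf_neq0 // IH -addn1 natrD mulrDl mul1r addrC.
case: n => m; first exact: H.
rewrite NegzE -exprnN Normc.normcV lnV ?posrE ?normc_gt0 ?expf_neq0 //.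
by rewrite H mulrNz mulNr.
Qed.

Lemma log_row_mono_pt kappa alpha beta s b :
  (forall b, kappa 0 b != 0) -> s != 0 -> s != 1 ->
  log_row (mono_pt kappa alpha beta s) 0 b = ln (normc (kappa 0 b)) +
    (alpha 0 b)%:~R * ln (normc s) + (beta 0 b)%:~R * ln (normc (s - 1)).
Proof.
move=> k0 s0 s1; have s10 : s - 1 != 0 by rewrite subr_eq0.
by rewrite !mxE !ln_normcM ?mulf_neq0 ?expfz_neq0 // !ln_normcX.
Qed.

(** The rays of a monomial curve, in the order of the punctures 1, 0, infinity.
    The signs are those of outward normals: coordinates tending to zero
    correspond to positive multiples of the normal of their divisor. *)
Definition tripod alpha beta : seq ('rV[int]_N * nat) :=
  [:: (- beta, 1%N); (- alpha, 1%N); (alpha + beta, 1%N)].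

Lemma support_tripodP alpha beta (v : 'rV[R]_N) :
  Defs.support R (tripod alpha beta) v <->
  exists x y, tropical_line x y /\
    v = x *: map_mx intr alpha + y *: map_mx intr beta.
Proof.
split.
  move=> [e [lam [+ l0 ->]]]; rewrite !inE.
  case/or3P => /eqP -> /=.
  - exists 0, (- lam); split; first by exists lam => //; constructor 2.
    by rewrite map_mxN scalerN scale0r add0r scaleNr.
  - exists (- lam), 0; split; first by exists lam => //; constructor 1.
    by rewrite map_mxN scalerN scale0r addr0 scaleNr.
  - exists lam, lam; split; first by exists lam => //; constructor 3.
    by rewrite map_mxD scalerDr.
move=> [x [y [[lam l0 h] ->]]].
case: h => -[-> ->].
- exists (- alpha, 1%N), lam; rewrite !inE eqxx orbT; split=> //.
  by rewrite map_mxN scalerN scale0r addr0 scaleNr.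
- exists (- beta, 1%N), lam; rewrite !inE eqxx; split=> //.
  by rewrite map_mxN scalerN scale0r add0r scaleNr.
- exists (alpha + beta, 1%N), lam; rewrite !inE eqxx !orbT; split=> //.
  by rewrite map_mxD scalerDr.
Qed.

Lemma mono_curve_Log_cvg kappa alpha beta :
  (forall b, kappa 0 b != 0) -> alpha != 0 -> beta != 0 -> alpha + beta != 0 ->
  Log_cvg (mono_curve kappa alpha beta) (Defs.support R (tripod alpha beta)).
Proof.
move=> k0 a0 b0 ab0.
have ln20 : (0 : R) <= ln 2 by apply: ln_ge0; lra.
pose Kb b : R := `|ln (normc (kappa 0 b))| + `|(alpha 0 b)%:~R| * ln 2 +
  `|(beta 0 b)%:~R| * ln 2.
have Kb0 b : 0 <= Kb b by rewrite !addr_ge0 // mulr_ge0.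
have near s x y : s != 0 -> s != 1 -> `|ln (normc s) - x| <= ln 2 ->
    `|ln (normc (s - 1)) - y| <= ln 2 ->
    sup_close (\sum_b Kb b) (log_row (mono_pt kappa alpha beta s))
      (x *: map_mx intr alpha + y *: map_mx intr beta).
  move=> s0 s1 sx sy b; rewrite log_row_mono_pt // !mxE.
  apply: (@le_trans _ _ (Kb b)); last first.
    by rewrite (bigD1 b) //= lerDl sumr_ge0.
  set k := ln _; set u := ln _ in sx *; set v := ln _ in sy *.
  rewrite (_ : _ - _ = k + (alpha 0 b)%:~R * (u - x) + (beta 0 b)%:~R * (v - y)); last by ring.
  apply: le_trans (ler_normD _ _) _; apply: lerD; last by rewrite normrM ler_wpM2l.
  by apply: le_trans (ler_normD _ _) _; apply: lerD => //; rewrite normrM ler_wpM2l.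
apply: (@Log_cvg_close _ _ _ _ (\sum_b Kb b)).
- by rewrite sumr_ge0.
- apply: closed_support => e; rewrite !inE.
  by case/or3P => /eqP -> //=; rewrite oppr_eq0.
- by move=> lam y; exact: support_scale.
- move=> _ [s [s0 s1] <-].
  have [|||||x [y [xy sx sy]]] := @ln_pair_near_tropical_line _ (normc s) (normc (s - 1)).
  + by rewrite normc_gt0.
  + by rewrite normc_gt0 subr_eq0.
  + have := normc_add s (- 1).
    by rewrite normc_opp Normc.normc1.
  + have := normc_add (s - 1) 1.
    by rewrite subrK Normc.normc1.
  + have := normc_add s (1 - s).
    by rewrite addrC subrK Normc.normc1 -[1 - s]opprB normc_opp.
  exists (x *: map_mx intr alpha + y *: map_mx intr beta); last exact: near.
  by apply/support_tripodP; exists x, y.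
- move=> v /support_tripodP [x [y [/tropical_line_near_ln_pair [r [r0 r1 rx ry]] ->]]].
  have E : (r%:C - 1 = (r - 1)%:C)%C by rewrite rmorphB.
  have s0 : (r%:C)%C != 0 by rewrite -normc_gt0 normc_real.
  have s1 : (r%:C)%C != 1 by rewrite -subr_eq0 E -normc_gt0 normc_real.
  exists (mono_pt kappa alpha beta (r%:C)%C); first by exists (r%:C)%C.
  by apply: near => //; rewrite ?E normc_real.
Qed.

End MonomialCurve.

(** * Unimodular changes of monomial coordinates *)

Section Unimodular.
Variable N : nat.
Implicit Types alpha beta : 'rV[int]_N.

Definition minor2 alpha beta (p q : 'I_N) : int :=
  alpha 0 p * beta 0 q - alpha 0 q * beta 0 p.

(** The matrix obtained from the identity by putting alpha and beta in the
    positions p and q has determinant the given minor, hence an inverse over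
    the integers; that inverse sends alpha and beta to basis vectors. *)
Lemma unimodular_straighten alpha beta p q (d := minor2 alpha beta p q) :
  d * d = 1 ->
  exists2 A : 'M[int]_N, A \in unitmx &
    A *m alpha^T = delta_mx p 0 /\ A *m beta^T = delta_mx q 0.
Proof.
move=> dd.
have pq : p != q.
  apply: contra_eqN dd => /eqP pq; by rewrite /d /minor2 pq subrr mul0r.
(* The linear forms dual to alpha and beta supported on the coordinates p, q,
   by Cramer's rule; d is its own inverse. *)
pose phi : 'cV[int]_N := d *: (beta 0 q *: delta_mx p 0 - beta 0 p *: delta_mx q 0).
pose psi : 'cV[int]_N := d *: (alpha 0 p *: delta_mx q 0 - alpha 0 q *: delta_mx p 0).
have coordE (x : 'rV[int]_N) (c : 'I_N) : x *m delta_mx c 0 = (x 0 c)%:M :> 'M_1.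
  by rewrite -colE; apply/matrixP => a b; rewrite !ord1 !mxE.
have phiE x : x *m phi = (d * (beta 0 q * x 0 p - beta 0 p * x 0 q))%:M.
  by rewrite -scalemxAr mulmxBr -!scalemxAr !coordE !scale_scalar_mx -raddfB /= scale_scalar_mx.
have psiE x : x *m psi = (d * (alpha 0 p * x 0 q - alpha 0 q * x 0 p))%:M.
  by rewrite -scalemxAr mulmxBr -!scalemxAr !coordE !scale_scalar_mx -raddfB /= scale_scalar_mx.
pose A : 'M[int]_N := 1%:M + phi *m (delta_mx 0 p - alpha) + psi *m (delta_mx 0 q - beta).
have AE x : x *m A = x + (d * (beta 0 q * x 0 p - beta 0 p * x 0 q)) *: (delta_mx 0 p - alpha)
    + (d * (alpha 0 p * x 0 q - alpha 0 q * x 0 p)) *: (delta_mx 0 q - beta).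
  by rewrite /A 2!mulmxDr mulmx1 !mulmxA phiE psiE !mul_scalar_mx.
have alphaA : alpha *m A = delta_mx 0 p.
  rewrite AE (_ : d * _ = 1); last by rewrite -dd /d /minor2; ring.
  rewrite (_ : d * _ = 0); last by ring.
  by rewrite scale1r scale0r addr0 addrC subrK.
have betaA : beta *m A = delta_mx 0 q.
  rewrite AE (_ : d * (beta 0 q * _ - _) = 0); last by ring.
  rewrite (_ : d * _ = 1); last by rewrite -dd /d /minor2; ring.
  by rewrite scale1r scale0r addr0 addrC subrK.
pose B : 'M[int]_N := \matrix_c (if c == p then alpha else if c == q then beta else delta_mx 0 c).
have BA : B *m A = 1%:M.
  apply/row_matrixP => c; rewrite row_mul rowK row1.
  have [->//|cp] := eqVneq c p; have [->//|cq] := eqVneq c q.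
  rewrite AE !mxE !eqxx /= ![_ == c]eq_sym (negPf cp) (negPf cq) /= !mulr0n !(mulr0, subr0).
  by rewrite !scale0r !addr0.
exists A^T; first by rewrite unitmx_tr; have [] := mulmx1_unit BA.
by rewrite -!trmx_mul alphaA betaA !trmx_delta.
Qed.

(** A common divisor of the coordinates of alpha divides every minor that
    involves alpha. *)
Lemma primitive_minor2 alpha beta p q :
  minor2 alpha beta p q * minor2 alpha beta p q = 1 -> primitive alpha.
Proof.
set d := minor2 alpha beta p q => dd.
rewrite /primitive; set g := (\big[_/_]_(_ < _) _)%N.
have gdvd b : (g %| alpha 0%R b)%Z.
  by rewrite dvdzE /g (bigD1 b) //= dvdn_gcdl.
have : (g %| d * d)%Z.
  by apply: dvdz_mull; rewrite /d /minor2 rpredB // dvdz_mulr.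
by rewrite dd dvdzE dvdn1.
Qed.

End Unimodular.

(** * Transversality of a line to a coordinate hyperplane *)

Lemma cross_multiply (K : fieldType) (g c h t h' : K) : h != 0 -> h' != 0 ->
  g / h - c = t / h' -> (g - c * h) * h' = t * h.
Proof.
move=> h0 h'0 E.
by rewrite -[t](divfK h'0) -E [RHS]mulrAC [(_ - _) * h in RHS]mulrBl divfK.
Qed.

Section CoordinateLine.
Variables (R : realType) (N : nat).
Local Notation C := R[i].
Variables (kappa : 'rV[C]_N) (p q : 'I_N).
Hypothesis kappa0 : forall b, kappa 0 b != 0.
Hypothesis pq : p != q.

(** The affine line on which coordinate p is proportional to s, coordinate q to
    s - 1, and all other coordinates are constant.  The point with s = 0 is its
    intersection with the hyperplane of coordinate p. *)
Definition line_pt (s : C) : 'rV[C]_N :=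
  \row_b (kappa 0 b * s ^+ (b == p) * (s - 1) ^+ (b == q)).

Definition punctured_line : set 'rV[C]_N :=
  [set line_pt s | s in [set s | s != 0 /\ s != 1]].

(** Restricting polynomials to the line reduces questions on ideals in N
    variables to one-variable polynomials. *)
Lemma mpoly_restrict_line (g : mpoly N C) :
  exists P : {poly C}, forall s, P.[s] = meval (line_pt s 0) g.
Proof.
exists (\sum_(m <- msupp g) mcoeff m g *: \prod_b
  ((kappa 0 b)%:P * 'X ^+ (b == p) * ('X - 1) ^+ (b == q)) ^+ (m b)) => s.
rewrite horner_sum mevalE; apply: eq_bigr => m _; rewrite hornerZ horner_prod.
by congr (_ * _); apply: eq_bigr => b _; rewrite !mxE !hornerE.
Qed.

Lemma poly_cofinite_eq0 (P : {poly C}) :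
  (forall s, s != 0 -> s != 1 -> P.[s] = 0) -> P = 0.
Proof.
move=> h; apply/eqP/contraT => P0.
have := max_poly_roots P0 (rs := [seq n.+2%:R | n <- iota 0 (size P)]).
rewrite size_map size_iota ltnn; apply.
  apply/allP => _ /mapP [n _ ->]; apply/rootP; apply: h.
    by rewrite pnatr_eq0.
  by rewrite (_ : 1 = 1%:R) // eqr_nat.
by rewrite map_inj_uniq ?iota_uniq // => a b /eqP; rewrite eqr_nat => /eqP [].
Qed.

(** The puncture s = 0 belongs to the closure of the punctured line, since a
    polynomial in s with infinitely many roots is zero. *)
Lemma vanishes_line0 g : vanishes_on punctured_line g -> meval (line_pt 0 0) g = 0.
Proof.
have [P PE] := mpoly_restrict_line g => h; rewrite -PE.
rewrite (_ : P = 0) ?horner0 //; apply: poly_cofinite_eq0 => s s0 s1.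
by rewrite PE; apply: h; exists s.
Qed.

Lemma line_ptp s : line_pt s 0 p = kappa 0 p * s.
Proof. by rewrite !mxE eqxx (negPf pq) expr0 expr1 mulr1. Qed.

Lemma line_ptq s : line_pt s 0 q = kappa 0 q * (s - 1).
Proof. by rewrite !mxE eqxx eq_sym (negPf pq) expr0 expr1 mulr1. Qed.

Lemma line_pt_other s b : b != p -> b != q -> line_pt s 0 b = kappa 0 b.
Proof. by move=> bp bq; rewrite !mxE (negPf bp) (negPf bq) !expr0 !mulr1. Qed.

Lemma closure_line_divisor :
  zariski_closure punctured_line `&` divisor_orbit p = [set line_pt 0].
Proof.
have k0 := kappa0.
apply/seteqP; split=> x; last first.
  move=> ->; split; first exact: vanishes_line0.
  move=> b; have [->|bp] := eqVneq b p; first by rewrite line_ptp mulr0 eqxx.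
  have [->|bq] := eqVneq b q; last by rewrite line_pt_other //; apply/negbTE.
  by rewrite line_ptq sub0r mulrN1 oppr_eq0; apply/negbTE.
move=> [clx /(_ p)]; rewrite eqxx => /eqP xp.
apply/rowP => b.
have [->|bp] := eqVneq b p; first by rewrite xp line_ptp mulr0.
have [->|bq] := eqVneq b q.
  have := clx (mpolyC N (kappa 0 p) * mpolyX C (mnm1 q)
    - mpolyC N (kappa 0 q) * mpolyX C (mnm1 p) + mpolyC N (kappa 0 p * kappa 0 q)).
  rewrite mevalD mevalB !mevalM !mevalC !mevalXU xp mulr0 subr0 -mulrDr => H.
  rewrite line_ptq sub0r mulrN1; apply/eqP; rewrite -subr_eq0 opprK.
  have /eqP : kappa 0 p * (x 0 q + kappa 0 q) = 0.
    apply: H => _ [s _ <-].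
    by rewrite mevalD mevalB !mevalM !mevalC !mevalXU line_ptp line_ptq; ring.
  by rewrite mulf_eq0 (negPf (k0 p)).
have := clx (mpolyX C (mnm1 b) - mpolyC N (kappa 0 b)).
rewrite mevalB mevalXU mevalC line_pt_other // => H.
apply/eqP; rewrite -subr_eq0; apply/eqP/H => _ [s _ <-].
by rewrite mevalB mevalXU mevalC line_pt_other // subrr.
Qed.

(** Modulo the ideal of the line every regular function is a function of s, and
    modulo coordinate p, a multiple of s, only its value at s = 0 is left.  So
    the local quotient is one-dimensional, spanned by 1. *)
Lemma line_intersection_mult : intersection_mult punctured_line p (line_pt 0) 1.
Proof.
have k0 := kappa0.
exists (fun _ => 1); split.
  by move=> _; exists 1, 1; rewrite meval1 oner_neq0 tofrac1 divr1.
move=> _ [g [h [h0 ->]]].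
have hF : FracField.tofrac h != 0 by rewrite tofrac_eq0; apply: contraNneq h0 => ->; rewrite meval0.
have sumE (c : 'rV[C]_1) : \sum_(b < 1) FracField.tofrac (mpolyC N (c 0 b)) * 1 =
   FracField.tofrac (mpolyC N (c 0 0)) by rewrite big_ord1 mulr1.
pose c0 := meval (line_pt 0 0) g / meval (line_pt 0 0) h.
exists (const_mx c0); split.
  rewrite sumE mxE.
  pose G := g - mpolyC N c0 * h.
  have [P PE] := mpoly_restrict_line G.
  have P0 : root P 0.
    by apply/rootP; rewrite PE mevalB mevalM mevalC divfK ?subrr.
  have /factor_theorem [Q QE] := P0.
  (* G vanishes at s = 0, so on the line G = s * Q(s); Y is the coordinate
     function s, and r represents Q(s) divided by the constant kappa_p. *)
  pose Y := mpolyC N (kappa 0 p)^-1 * mpolyX C (mnm1 p).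
  pose r := mpolyC N (kappa 0 p)^-1 * (map_poly (@mpolyC N C) Q).[Y].
  exists (G - mpolyX C (mnm1 p) * r), r, h; split=> //.
    move=> _ [s _ <-].
    have YE : meval (line_pt s 0) Y = s.
      by rewrite mevalM mevalC mevalXU line_ptp mulKf.
    have rE : meval (line_pt s 0) r = (kappa 0 p)^-1 * Q.[s].
      rewrite mevalM mevalC -(horner_map (meval (line_pt s 0))) /= YE -map_poly_comp.
      by rewrite map_poly_id // => c _; exact: mevalC.
    rewrite mevalB mevalM mevalXU line_ptp rE -PE QE subr0 hornerM hornerX.
    by rewrite mulrACA mulfV // mul1r mulrC subrr.
  rewrite subrK /G tofracB tofracM mulrBl mulfK //.
move=> c; rewrite sumE => -[G [r [h' [vG h'0 E]]]].
have h'F : FracField.tofrac h' != 0.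
  by rewrite tofrac_eq0; apply: contraNneq h'0 => ->; rewrite meval0.
have {}E : (g - mpolyC N (c 0 0) * h) * h' = (G + mpolyX C (mnm1 p) * r) * h.
  apply/eqP; rewrite -tofrac_eq !tofracM tofracB tofracM; apply/eqP.
  exact: (cross_multiply hF h'F E).
have := congr1 (meval (line_pt 0 0)) E.
rewrite !mevalM mevalB mevalD !mevalM mevalXU line_ptp mulr0 mul0r addr0.
rewrite (vanishes_line0 vG) mul0r mevalC => /eqP.
rewrite mulf_eq0 (negPf h'0) orbF subr_eq0 => /eqP gE.
by apply/rowP => b; rewrite ord1 mxE /c0 gE mulfK.
Qed.

End CoordinateLine.

(** * Weights of the ends of a monomial curve *)

Section MonomialCurveWeights.
Variables (R : realType) (N : nat).
Local Notation C := R[i].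
Implicit Types (kappa : 'rV[C]_N) (alpha beta : 'rV[int]_N).

Lemma monomial_map_mono_pt (A : 'M[int]_N) kappa alpha beta s :
  s != 0 -> s != 1 ->
  monomial_map A (mono_pt kappa alpha beta s) =
  mono_pt (monomial_map A kappa) (alpha *m A^T) (beta *m A^T) s.
Proof.
move=> s0 s1; have s10 : s - 1 != 0 by rewrite subr_eq0.
have prodX (z : C) (gamma : 'rV[int]_N) b : z != 0 ->
    z ^ (gamma *m A^T) 0 b = \prod_c (z ^ gamma 0 c) ^ A b c.
  move=> z0; rewrite !mxE.
  rewrite (big_morph (fun m => z ^ m) (id1 := 1) (op1 := *%R)) //; last first.
    by move=> m n; rewrite expfzDr.
  by apply: eq_bigr => c _; rewrite exprz_exp !mxE.
apply/rowP => b; rewrite mxE [RHS]mxE !prodX // mxE -!big_split /=.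
by apply: eq_bigr => c _; rewrite mxE !expfzMl.
Qed.

(** When alpha and beta span a saturated rank 2 lattice, s and s - 1 are
    themselves monomials in the coordinates up to constants, so that in suitable
    monomial coordinates the curve is a line transversal to the divisor. *)
Lemma mono_curve_edge_weight kappa alpha beta p q :
  (forall b, kappa 0 b != 0) ->
  minor2 alpha beta p q * minor2 alpha beta p q = 1 ->
  edge_weight (mono_curve kappa alpha beta) (- alpha) 1.
Proof.
move=> k0 dd.
have pq : p != q.
  by apply: contra_eqN dd => /eqP ->; rewrite /minor2 subrr mul0r.
have [A Au [Aa Ab]] := unimodular_straighten dd.
exists A, p; split=> //; first by rewrite linearN mulmxN Aa.
pose kappa' := monomial_map A kappa.
have k'0 b : kappa' 0 b != 0.
  by rewrite mxE prodf_seq_neq0; apply/allP => c _; apply/implyP => _; rewrite expfz_neq0.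
have -> : monomial_map A @` mono_curve kappa alpha beta = punctured_line kappa' p q.
  have E s : s != 0 -> s != 1 ->
      monomial_map A (mono_pt kappa alpha beta s) = line_pt kappa' p q s.
    move=> s0 s1; rewrite monomial_map_mono_pt //.
    have -> : alpha *m A^T = delta_mx 0 p by apply: trmx_inj; rewrite trmx_mul trmxK Aa trmx_delta.
    have -> : beta *m A^T = delta_mx 0 q by apply: trmx_inj; rewrite trmx_mul trmxK Ab trmx_delta.
    by apply/rowP => b; rewrite !mxE eqxx /=; case: (b == p); case: (b == q).
  apply/seteqP; split=> [_ [_ [s [s0 s1] <-] <-]|_ [s [s0 s1] <-]].
    by exists s => //; rewrite E.
  by exists (mono_pt kappa alpha beta s); [exists s | rewrite E].
exists [:: line_pt kappa' p q 0], (fun _ => 1%N); split=> //.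
- by rewrite closure_line_divisor //; apply/seteqP; split=> x /=; rewrite inE => /eqP.
- by move=> x; rewrite inE => /eqP ->; exact: line_intersection_mult.
- by rewrite big_seq1.
Qed.

Lemma mono_curve_reparam kappa kappa' alpha alpha' beta beta' (h : C -> C) :
  (forall s, s != 0 /\ s != 1 -> (h s != 0 /\ h s != 1) /\ h (h s) = s) ->
  (forall s, s != 0 -> s != 1 ->
    mono_pt kappa alpha beta (h s) = mono_pt kappa' alpha' beta' s) ->
  mono_curve kappa alpha beta = mono_curve kappa' alpha' beta'.
Proof.
move=> hh hE; apply/seteqP; split=> _ [s ss <-]; have [hs hhs] := hh s ss.
  by exists (h s) => //; rewrite -(hE _ hs.1 hs.2) hhs.
by exists (h s) => //; rewrite (hE _ ss.1 ss.2).
Qed.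

(** The automorphism s -> 1 - s of the line exchanges the punctures 0 and 1. *)
Lemma mono_curve_swap kappa alpha beta : (forall b, kappa 0 b != 0) ->
  exists2 kappa' : 'rV[C]_N, (forall b, kappa' 0 b != 0) &
    mono_curve kappa alpha beta = mono_curve kappa' beta alpha.
Proof.
move=> k0; exists (\row_b (kappa 0 b * (- 1) ^ alpha 0 b * (- 1) ^ beta 0 b)).
  by move=> b; rewrite mxE !mulf_neq0 ?expfz_neq0 ?oppr_eq0 ?oner_neq0.
apply: (@mono_curve_reparam _ _ _ _ _ _ (fun s => 1 - s)) => [s [s0 s1]|s s0 s1].
  rewrite subKr; split=> //; split.
    by rewrite subr_eq0 eq_sym.
  by rewrite -subr_eq0 [1 - s]addrC addrK oppr_eq0.
apply/rowP => b; rewrite !mxE.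
rewrite (_ : 1 - s = -1 * (s - 1)); last by ring.
rewrite (_ : -1 * (s - 1) - 1 = -1 * s); last by ring.
by rewrite !expfzMl !mulrA -[LHS]mulrA [LHS]mulrAC !mulrA.
Qed.

(** The automorphism s -> 1 / s of the line exchanges the punctures 0 and
    infinity. *)
Lemma mono_curve_invert kappa alpha beta : (forall b, kappa 0 b != 0) ->
  exists2 kappa' : 'rV[C]_N, (forall b, kappa' 0 b != 0) &
    mono_curve kappa alpha beta = mono_curve kappa' (- (alpha + beta)) beta.
Proof.
move=> k0; exists (\row_b (kappa 0 b * (- 1) ^ beta 0 b)).
  by move=> b; rewrite mxE !mulf_neq0 ?expfz_neq0 ?oppr_eq0 ?oner_neq0.
apply: (@mono_curve_reparam _ _ _ _ _ _ (fun s => s^-1)) => [s [s0 s1]|s s0 s1].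
  by rewrite invrK invr_eq0 invr_eq1.
apply/rowP => b; rewrite !mxE opprD expfzDr // -!exprz_inv.
rewrite (_ : s^-1 - 1 = -1 * s^-1 * (s - 1)); last by field.
by rewrite !expfzMl !mulrA; congr (_ * _ * _); exact: mulrAC.
Qed.

(** By the two symmetries the weight computation at s = 0 applies to all three
    ends; up to sign the minor is the same for each of them. *)
Lemma mono_curve_trop kappa alpha beta p q :
  (forall b, kappa 0 b != 0) ->
  minor2 alpha beta p q * minor2 alpha beta p q = 1 ->
  fan_tropical_curve (tripod alpha beta) /\
  trop_curve (mono_curve kappa alpha beta) (tripod alpha beta).
Proof.
move=> k0 dd.
have dd2 : minor2 beta alpha p q * minor2 beta alpha p q = 1.
  by rewrite -dd /minor2; ring.
have dd3 : minor2 (- (alpha + beta)) beta p q * minor2 (- (alpha + beta)) beta p q = 1.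
  by rewrite -dd /minor2 !mxE; ring.
have primN (v : 'rV[int]_N) : primitive (- v) = primitive v.
  by rewrite /primitive; congr (_ == _); apply: eq_bigr => b _; rewrite mxE abszN.
have prim0 (v : 'rV[int]_N) : primitive v -> v != 0.
  by apply: contraTneq => ->; rewrite /primitive big1 // => b _; rewrite mxE.
have pa : primitive alpha := primitive_minor2 dd.
have pb : primitive beta := primitive_minor2 dd2.
have pab : primitive (alpha + beta) by rewrite -primN; exact: primitive_minor2 dd3.
split.
  split=> //.
  - rewrite /= !inE !negb_or andbT.
    have nz : minor2 alpha beta p q <> 0 by move=> d0; move: dd; rewrite d0 mul0r.
    apply/andP; split; [apply/andP; split|]; apply/eqP => E; apply: nz; rewrite /minor2.
    + by rewrite (oppr_inj E); ring.
    + have -> : alpha = beta *- 2 by rewrite -[alpha](addrK beta) -E mulr2n opprD.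
      by rewrite !mxE; ring.
    + have -> : beta = alpha *- 2 by rewrite -[beta](addKr alpha) -E mulr2n opprD.
      by rewrite !mxE; ring.
  - by move=> e; rewrite !inE => /or3P [] /eqP ->; rewrite /= ?primN.
  - by rewrite !big_cons big_nil /= !mulr1n addr0 addKr addNr.
split; first by apply: mono_curve_Log_cvg; rewrite // prim0.
move=> e; rewrite !inE => /or3P [] /eqP -> /=.
- have [k' k'0 ->] := mono_curve_swap alpha beta k0.
  exact: mono_curve_edge_weight dd2.
- exact: mono_curve_edge_weight dd.
- have [k' k'0 ->] := mono_curve_invert alpha beta k0.
  by have := mono_curve_edge_weight k'0 dd3; rewrite opprK.
Qed.

End MonomialCurveWeights.

(** * Lines cutting a parametrized conic at three points *)

Section LinesAndConic.
Variable R : realType.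
Local Notation C := R[i].
Implicit Types (u v z : 'rV[C]_3) (zeta : C -> C -> 'rV[C]_3).

Lemma lformE u z : lform u z = \sum_c u 0 c * z 0 c.
Proof. by rewrite /lform mxE; apply: eq_bigr => c _; rewrite mxE. Qed.

Lemma lformZl (d : C) u z : lform (d *: u) z = d * lform u z.
Proof. by rewrite /lform -scalemxAl mxE. Qed.

Lemma lformZr (d : C) u z : lform u (d *: z) = d * lform u z.
Proof. by rewrite /lform linearZ /= -scalemxAr mxE. Qed.

Lemma lform0r u : lform u 0 = 0.
Proof. by rewrite /lform trmx0 mulmx0 mxE. Qed.

Lemma lform_delta u c : lform u (delta_mx 0 c) = u 0 c.
Proof. by rewrite /lform trmx_delta -colE mxE. Qed.

(** For each index x the vector u_c e_x - u_x e_c lies on the line u = 0; the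
    vanishing of v there says that v is proportional to u. *)
Lemma lform_coeff u v : u != 0 -> (forall z, lform u z = 0 -> lform v z = 0) ->
  exists d, v = d *: u.
Proof.
move=> /rV0Pn [c uc] h; exists (v 0 c / u 0 c); apply/rowP => x; rewrite mxE.
have lD w (m n : C) : lform w (m *: delta_mx 0 x - n *: delta_mx 0 c) =
    m * w 0 x - n * w 0 c.
  rewrite /lform linearB /= mulmxBr mxE [X in _ + X]mxE.
  by rewrite -![(w *m _) 0 0]/(lform w _) !lformZr !lform_delta.
have := h (u 0 c *: delta_mx 0 x - u 0 x *: delta_mx 0 c).
rewrite !lD mulrC subrr => /(_ erefl)/eqP; rewrite subr_eq0 => /eqP E.
by apply: (mulfI uc); rewrite E; field.
Qed.

Lemma proj_line_eq u v : u != 0 -> proj_line v = proj_line u ->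
  exists2 d, d != 0 & v = d *: u.
Proof.
move=> u0 E.
have [d vE] : exists d, v = d *: u.
  apply: lform_coeff => // z uz.
  have [->|z0] := eqVneq z 0; first exact: lform0r.
  by have [] : proj_line v z by rewrite E.
exists d => //; apply: contraNneq u0 => d0; apply/eqP/rowP => c; rewrite mxE.
have : proj_line u (delta_mx 0 c).
  rewrite -E vE d0 scale0r; split; last by rewrite /lform mul0mx mxE.
  by apply/rV0Pn; exists c; rewrite mxE !eqxx oner_neq0.
by case=> _; rewrite lform_delta.
Qed.

(** The line u = 0 cuts the conic parametrized by zeta at the points with
    parameters s = 0, s = t and t = 0, with multiplicities m, n and o. *)
Definition cuts zeta u (m n o : nat) := exists2 c, c != 0 &
  forall s t, lform u (zeta s t) = c * (s ^+ m * (s - t) ^+ n * t ^+ o).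

Lemma cuts_neq0 zeta u m n o : cuts zeta u m n o -> u != 0.
Proof.
move=> [c c0 /(_ 2 1)]; apply: contra_eqN => /eqP ->.
rewrite /lform mul0mx mxE eq_sym (_ : 2 - 1 = 1); last by ring.
by rewrite !expr1n !mulr1 mulf_neq0 // expf_neq0 // pnatr_eq0.
Qed.

Lemma cuts_proj_line zeta u v m n o :
  proj_line v = proj_line u -> cuts zeta u m n o -> cuts zeta v m n o.
Proof.
move=> E cu; have [d d0 ->] := proj_line_eq (cuts_neq0 cu) E.
have [c c0 h] := cu; exists (d * c); first exact: mulf_neq0.
by move=> s t; rewrite lformZl h mulrA.
Qed.

End LinesAndConic.

Section PlaneOfLines.
Variables (R : realType) (N : nat).
Local Notation C := R[i].
Implicit Types (g : 'I_N.+1 -> 'rV[C]_3) (zeta : C -> C -> 'rV[C]_3) (a b e : 'I_N.+1 -> nat).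

(** The coordinates of the sum of the a_r u_r: the valuations at a point of the
    functions f_0 / f_r, when a_r is the vanishing order of f_r. *)
Definition ray a : 'rV[int]_N := \row_x ((a ord0)%:Z - (a (lift ord0 x))%:Z).

Lemma uvec_ray (r : 'I_N.+1) : uvec r = ray (fun s => s == r).
Proof.
apply/rowP => x; rewrite /uvec; case: unliftP => [y ->|->]; last first.
  by rewrite !mxE eqxx [_ == ord0]eq_sym (negPf (neq_lift _ _)).
by rewrite !mxE eqxx /= (inj_eq lift_inj) sub0r eq_sym natz.
Qed.

Lemma rayD a b : ray a + ray b = ray (fun s => a s + b s)%N.
Proof. by apply/rowP => x; rewrite !mxE !PoszD; ring. Qed.

Lemma ray_double a : ray a *+ 2 = ray (fun s => a s * 2)%N.
Proof. by apply/rowP => x; rewrite mulr2n !mxE !PoszM; ring. Qed.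

(** Balancing: each line meets a conic in two points with multiplicity, and the
    sum of all the u_r is zero. *)
Lemma ray_balance a b e : (forall r, a r + b r + e r = 2)%N ->
  - ray a + - ray b = ray e.
Proof.
move=> h; apply/rowP => x; rewrite !mxE; have := h ord0; have := h (lift ord0 x); lia.
Qed.

(** In homogeneous form the minor is half of a 3 by 3 determinant of exponents:
    the forms s(s - t) and t(s - t) have the quotient s / t, and any third line
    whose exponent at 1 is even provides s / t - 1 up to this quotient.  Which
    two coordinates to use depends on which line is the line of index 0, by
    which all others are divided. *)
Lemma minor2_ray a b i j k :
  (a i, b i) = (1, 1)%N -> (a j, b j) = (0, 1)%N -> (a k, b k) = (2, 0)%N ->
  (forall r, [\/ r = i, r = j, b r = 0%N | b r = 2%N]) ->
  exists p q, minor2 (- ray a) (- ray b) p q * minor2 (- ray a) (- ray b) p q = 1.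
Proof.
move=> [ai bi] [aj bj] [ak bk] br.
have lifted (r : 'I_N.+1) : r != ord0 -> exists x, r = lift ord0 x.
  by case: (unliftP ord0 r) => [x ->|-> /eqP //]; exists x.
have neq0 (r s : 'I_N.+1) : r = ord0 -> r != s -> s != ord0.
  by move=> ->; rewrite eq_sym.
have ij : i != j by apply: contra_eqN ai => /eqP ->; rewrite aj.
have ik : i != k by apply: contra_eqN ai => /eqP ->; rewrite ak.
have jk : j != k by apply: contra_eqN aj => /eqP ->; rewrite ak.
have minorE x y : minor2 (- ray a) (- ray b) x y =
    ((a (lift ord0 x))%:Z - (a ord0)%:Z) * ((b (lift ord0 y))%:Z - (b ord0)%:Z)
    - ((a (lift ord0 y))%:Z - (a ord0)%:Z) * ((b (lift ord0 x))%:Z - (b ord0)%:Z).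
  by rewrite /minor2 !mxE !opprB.
have [i0|i0] := eqVneq i ord0.
  have [[x xE] [y yE]] := (lifted j (neq0 _ _ i0 ij), lifted k (neq0 _ _ i0 ik)).
  by exists x, y; rewrite minorE -xE -yE -i0 ai bi aj bj ak bk.
have [x xE] := lifted i i0.
have [j0|j0] := eqVneq j ord0.
  have [y yE] := lifted k (neq0 _ _ j0 jk).
  by exists x, y; rewrite minorE -xE -yE -j0 ai bi aj bj ak bk.
have [y yE] := lifted j j0.
exists x, y; rewrite minorE -xE -yE ai bi aj bj.
have [r0|r0|->|->] := br ord0; [by rewrite r0 eqxx in i0|by rewrite r0 eqxx in j0|ring|ring].
Qed.




(** All the forms restrict to binary forms of the same degree 2, so the
    coordinates f_r / f_0 are monomials in s / t and s / t - 1.  The lines i, k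
    and l remove the parameters 1, 0 and infinity from the curve. *)
Lemma plane_curve_mono g (F : mpoly 3 C) zeta a b e i k l :
  (forall s t, meval (zeta s t 0) F = 0) ->
  (forall z : 'rV[C]_3, meval (z 0) F = 0 -> lform (g k) z != 0 ->
    exists s t lam, lam != 0 /\ z = lam *: zeta s t) ->
  (forall r, cuts zeta (g r) (a r) (b r) (e r)) ->
  (forall r, a r + b r + e r = 2)%N ->
  (0 < b i)%N -> (0 < a k)%N -> (0 < e l)%N ->
  exists2 kappa : 'rV[C]_N, (forall x, kappa 0 x != 0) &
    plane_curve g F = mono_curve kappa (- ray a) (- ray b).
Proof.
move=> Fz Fsurj cutg abe bi ak el.
have exc r : exists c : C, c != 0 /\ forall s t,
    lform (g r) (zeta s t) = c * (s ^+ a r * (s - t) ^+ b r * t ^+ e r).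
  by have [c c0 h] := cutg r; exists c.
have [c cP] := boolp.choice exc.
have c0 r : c r != 0 by have [] := cP r.
have cE r s t := (cP r).2 s t.
exists (\row_x (c (lift ord0 x) / c ord0)) => [x|].
  by rewrite mxE mulf_neq0 // invr_eq0.
have gE r lam s t : t != 0 -> lform (g r) (lam *: zeta s t) =
    lam * t ^+ 2 * (c r * ((s / t) ^+ a r * (s / t - 1) ^+ b r)).
  move=> t0; rewrite lformZr cE -(abe r) !exprD.
  rewrite (_ : s / t - 1 = (s - t) / t); last by field.
  rewrite !expr_div_n; field.
  by rewrite !expf_neq0.
have torusE lam s t : lam != 0 -> s != 0 -> t != 0 -> s != t ->
    to_torus g (lam *: zeta s t) =
    mono_pt (\row_x (c (lift ord0 x) / c ord0)) (- ray a) (- ray b) (s / t).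
  move=> lam0 s0 t0 st; apply/rowP => x; rewrite !mxE !gE // !opprB.
  have st0 : s / t != 0 by rewrite mulf_neq0 // invr_eq0.
  have st1 : s / t - 1 != 0.
    by rewrite subr_eq0; apply: contra_neq st => /(congr1 (fun u => u * t)); rewrite divfK // mul1r.
  rewrite !expfzDr // -!exprnN !exprnP; field.
  by rewrite lam0 t0 c0 !expf_neq0.
apply/seteqP; split.
  move=> _ [z [zoff Fz0] <-].
  have [s [t [lam [lam0 zE]]]] := Fsurj z Fz0 (zoff k).
  have off r : lform (g r) (zeta s t) != 0.
    by have := zoff r; rewrite zE lformZr mulf_eq0 negb_or lam0.
  have s0 : s != 0.
    by apply: contra_neq (off k) => ->; rewrite cE expr0n gtn_eqF // !(mul0r, mulr0).
  have t0 : t != 0.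
    by apply: contra_neq (off l) => ->; rewrite cE [0 ^+ _]expr0n gtn_eqF // !(mul0r, mulr0).
  have st : s != t.
    apply: contra_neq (off i) => ->.
    by rewrite cE subrr [0 ^+ _]expr0n gtn_eqF // !(mul0r, mulr0).
  exists (s / t); last by rewrite zE torusE.
  split; first by rewrite mulf_neq0 // invr_eq0.
  by apply: contra_neq st => /(congr1 (fun u => u * t)); rewrite divfK // mul1r.
move=> _ [s [s0 s1] <-].
exists (zeta s 1); last by rewrite -[zeta s 1]scale1r torusE ?oner_neq0 // divr1.
split=> // r; rewrite cE expr1n mulr1 mulf_neq0 // mulf_neq0 // expf_neq0 //.
by rewrite subr_eq0.
Qed.

End PlaneOfLines.

(** * Planes in which the conic is finely approximating *)

Section Core.
Variables (R : realType) (N : nat).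
Local Notation C := R[i].
Implicit Types (g : 'I_N.+1 -> 'rV[C]_3) (zeta : C -> C -> 'rV[C]_3) (a b e : 'I_N.+1 -> nat).

Lemma zeta_proj_line zeta u m n o s t : (forall x y : C, x != 0 \/ y != 0 -> zeta x y != 0) ->
  cuts zeta u m n o -> s != 0 \/ t != 0 ->
  (proj_line u (zeta s t) <->
   s ^+ m * (s - t) ^+ n * t ^+ o = 0).
Proof.
move=> z0 [c c0 h] st; split=> [[_ /eqP]|E].
  by rewrite h mulf_eq0 (negPf c0) => /eqP.
by split; [exact: z0 | rewrite h E mulr0].
Qed.

(** Distinct lines are told apart by which of the three points they contain:
    nonnegative triples of sum 2 are determined by their supports. *)
Lemma line_arrangement_cuts g zeta a b e i j k :
  (forall x y : C, x != 0 \/ y != 0 -> zeta x y != 0) ->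
  (forall r, cuts zeta (g r) (a r) (b r) (e r)) ->
  (forall r, a r + b r + e r = 2)%N ->
  (forall r s, a r = a s -> b r = b s -> r = s) ->
  proj_line (g i) `&` proj_line (g j) `&` proj_line (g k) = set0 ->
  line_arrangement g.
Proof.
move=> z0 cutg abe inj ijk; split.
- by move=> r; exact: cuts_neq0 (cutg r).
- move=> r r' E.
  have P (s t : C) : s != 0 \/ t != 0 ->
      (s ^+ a r * (s - t) ^+ b r * t ^+ e r == 0) =
      (s ^+ a r' * (s - t) ^+ b r' * t ^+ e r' == 0).
    move=> st; have H := zeta_proj_line z0 (cutg r) st.
    have H' := zeta_proj_line z0 (cutg r') st.
    by apply/eqP/eqP; [move/H; rewrite E => /H' | move/H'; rewrite -E => /H].
  have n1 : (- 1 : C) != 0 by rewrite oppr_eq0 oner_neq0.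
  have pa : (0 < a r)%N = (0 < a r')%N.
    have := P 0 1 (or_intror (oner_neq0 _)).
    by rewrite sub0r !expr1n !mulr1 !mulf_eq0 !expf_eq0 eqxx (negPf n1) !andbF !orbF !andbT.
  have pb : (0 < b r)%N = (0 < b r')%N.
    have := P 1 1 (or_intror (oner_neq0 _)).
    by rewrite subrr !expr1n !mulr1 !mul1r !expf_eq0 eqxx !andbT.
  have pe : (0 < e r)%N = (0 < e r')%N.
    have := P 1 0 (or_introl (oner_neq0 _)).
    by rewrite subr0 !expr1n !mul1r !expf_eq0 eqxx !andbT.
  by apply: inj; have := abe r; have := abe r'; lia.
- apply/seteqP; split=> // z h.
  by rewrite -ijk; split; [split|]; exact: h.
Qed.

Lemma plane_curve_sub_plane g F : plane_curve g F `<=` plane g.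
Proof. by move=> _ [z [zoff _] <-]; exists z. Qed.

Lemma Trop_sub (X Y : set 'rV[C]_N) : X `<=` Y -> Trop X `<=` Trop Y.
Proof.
move=> XY x hx U /hx; apply: filterS => t [_ [[z Xz <-] Uz]].
by exists (Log t z); split=> //; exists z => //; exact: XY.
Qed.

Lemma finely_approximable_cuts g (F : mpoly 3 C) zeta a b e i j k l :
  F \is ishomog1 2 mdeg -> irreducible_mpoly F ->
  (forall s t, meval (zeta s t 0) F = 0) ->
  (forall z : 'rV[C]_3, meval (z 0) F = 0 -> lform (g k) z != 0 ->
    exists s t lam, lam != 0 /\ z = lam *: zeta s t) ->
  (forall r, cuts zeta (g r) (a r) (b r) (e r)) ->
  (forall r, a r + b r + e r = 2)%N ->
  (a i, b i) = (1, 1)%N -> (a j, b j) = (0, 1)%N -> (a k, b k) = (2, 0)%N ->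
  (a l, b l) = (0, 0)%N ->
  (forall r, [\/ r = i, r = j, b r = 0%N | b r = 2%N]) ->
  finely_approximable g [:: (ray b, 1%N); (ray a, 1%N); (ray e, 1%N)].
Proof.
move=> Fh Firr Fz Fsurj cutg abe i_ j_ k_ l_ b02.
have [p [q dd]] := minor2_ray i_ j_ k_ b02.
have [kappa k0 XE] : exists2 kappa : 'rV[C]_N, (forall x, kappa 0 x != 0) &
    plane_curve g F = mono_curve kappa (- ray a) (- ray b).
  apply: (plane_curve_mono Fz Fsurj cutg abe (i := i) (l := l)).
  - by case: i_ => _ ->.
  - by case: k_ => ->.
  - by have := abe l; case: l_ => -> ->; lia.
have [fan [Lcvg wt]] := mono_curve_trop k0 dd.
rewrite /tripod !opprK (ray_balance abe) in fan Lcvg wt.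
exists 2, F; split=> //.
- have [<- _] := Lcvg; rewrite -XE; apply: Trop_sub; exact: plane_curve_sub_plane.
- rewrite XE; exists (mono_pt kappa (- ray a) (- ray b) 2), 2 => //; split.
    by rewrite pnatr_eq0.
  by rewrite -subr_eq0 (_ : 2 - 1 = 1) ?oner_neq0 //; ring.
- by rewrite XE.
Qed.

End Core.

(** * From rays of the limit to coefficients of the equation *)

Section Asymptotics.
Variables (R : realType).

Lemma gap_dominates (w w' w0 n n' n0 l ld : R) : 0 < l -> 2 * `|ld| < l ->
  n + 1 <= n' ->
  `|(w - w0) - (n0 - n) * l| <= 4^-1 * l ->
  `|(w' - w0) - (n0 - n') * l| <= 4^-1 * l ->
  w' <= ld + w.
Proof.
move=> l0 ldl nn'; rewrite !ler_norml => /andP[h2 _] /andP[_ h1].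
have h3 : - `|ld| <= ld by rewrite lerNnormlW.
have h4 : (n + 1) * l <= n' * l by rewrite ler_wpM2r // ltW.
by rewrite !mulrBl in h1 h2; rewrite mulrDl mul1r in h4; lra.
Qed.

Local Notation C := R[i].
Local Notation normc := (@ComplexField.Normc.normc R).

(** Near the ray sum v_r u_r the form f_r has size about t^(- v_r), relative to
    the others; the inequalities between the integers v_r thus become
    arbitrarily strong domination between the forms. *)
Lemma ray_dominance N (f : 'I_N.+1 -> 'rV[C]_3) (F : mpoly 3 C) (v : 'I_N.+1 -> nat) :
  Log_liminf (plane_curve f F) (map_mx intr (ray v)) ->
  forall delta : R, 0 < delta -> exists z, [/\ off_lines f z, meval (z 0) F = 0 &
    forall r s, (v r < v s)%N -> normc (lform (f s) z) <= delta * normc (lform (f r) z)].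
Proof.
move=> hv delta d0.
(* An error of 1/4 in each of two logarithms leaves half of the gap, which is at
   least 1. *)
have e0 : (0 : R) < 4^-1 by rewrite invr_gt0 ltr0n.
have [t tlarge [_ [[_ [z [zoff Fz] <-] <-] bz]]] :=
  pinfty_ex_gt (num_real (expR (2 * `|ln delta|))) (hv _ (nbhsx_ballx _ _ e0)).
exists z; split=> // r s rs.
have t0 : 0 < t by apply: lt_trans tlarge; exact: expR_gt0.
have lnt : 2 * `|ln delta| < ln t.
  by rewrite -[X in X < _]expRK ltr_ln ?posrE ?expR_gt0.
have lt0 : 0 < ln t by apply: le_lt_trans lnt; rewrite mulr_ge0.
have f0 r' : lform (f r') z != 0 by exact: zoff.
pose w r' := ln (normc (lform (f r') z)).
have wE r' : `|(w r' - w ord0) - ((v ord0)%:R - (v r')%:R) * ln t| <= 4^-1 * ln t.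
  case: (unliftP ord0 r') => [x ->|->]; last first.
    by rewrite !subrr mul0r subr0 normr0 mulr_ge0 // ltW.
  move/row_ballP: bz => /(_ e0 x); rewrite !mxE => /ltW.
  rewrite Normc.normcM Normc.normcV ln_div ?posrE ?normc_gt0 //.
  rewrite -/(w _) -/(w _) rmorphB /= !pmulrn => h.
  set W := w _ - _ in h *; set V := _ - _ in h *.
  rewrite -[W](divfK (lt0r_neq0 lt0)) -mulrBl -opprB mulNr normrN normrM.
  by rewrite [`|ln t|]gtr0_norm // ler_wpM2r // ltW.
have vrs : (v r)%:R + 1 <= (v s)%:R :> R by rewrite natr1 ler_nat.
have key : w s <= ln delta + w r.
  exact: gap_dominates lt0 lnt vrs (wE r) (wE s).
rewrite -ler_ln ?posrE ?mulr_gt0 ?normc_gt0 //.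
by rewrite lnM ?posrE ?normc_gt0.
Qed.

Lemma small_eq0 (c : C) (K : R) :
  (forall delta, 0 < delta -> delta <= 1 -> normc c <= K * delta) -> c = 0.
Proof.
move=> h; apply/eqP/contraT; rewrite -normc_gt0 => c0.
have K0 : 0 < K by have := lt_le_trans c0 (h 1 ltr01 (lexx _)); rewrite mulr1.
have d0 : 0 < normc c / (2 * K) by rewrite divr_gt0 // mulr_gt0.
have [d1|d1] := leP (normc c / (2 * K)) 1.
  have := h _ d0 d1; rewrite (_ : K * _ = normc c / 2); first by lra.
  by field; rewrite gt_eqF.
by have := h 1 ltr01 (lexx _); rewrite ltr_pdivlMr ?mulr_gt0 // in d1; lra.
Qed.

Lemma normc_sum5 (a1 a2 a3 a4 a5 m1 m2 m3 m4 m5 : C) (delta : R) :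
  normc m1 <= delta -> normc m2 <= delta -> normc m3 <= delta ->
  normc m4 <= delta -> normc m5 <= delta ->
  normc (a1 * m1 + a2 * m2 + a3 * m3 + a4 * m4 + a5 * m5) <=
  (normc a1 + normc a2 + normc a3 + normc a4 + normc a5) * delta.
Proof.
move=> h1 h2 h3 h4 h5; rewrite !mulrDl.
have step (u v : C) (p q : R) : normc u <= p -> normc v <= q -> normc (u + v) <= p + q.
  by move=> hu hv; apply: le_trans (normc_add _ _) _; exact: lerD.
have term (c m : C) : normc m <= delta -> normc (c * m) <= normc c * delta.
  by move=> hm; rewrite Normc.normcM; apply: ler_wpM2l; first exact: normc_ge0.
by rewrite (step _ _ _ _ (step _ _ _ _ (step _ _ _ _ (step _ _ _ _
  (term _ _ h1) (term _ _ h2)) (term _ _ h3)) (term _ _ h4)) (term _ _ h5)).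
Qed.

(** Points on the quadric with y and w negligible against x: after division by
    x^2 only the first coefficient remains in the limit. *)
Lemma dominant_coeffs (q11 q12 q13 q22 q23 q33 : C) :
  (forall delta : R, 0 < delta -> exists x y w : C,
    [/\ x != 0,
     q11 * x ^+ 2 + q12 * (x * y) + q13 * (x * w) + q22 * y ^+ 2
       + q23 * (y * w) + q33 * w ^+ 2 = 0,
     normc y <= delta * normc x & normc w <= delta * normc x]) ->
  q11 = 0.
Proof.
move=> h; apply: (@small_eq0 _ (normc q12 + normc q13 + normc q22 + normc q23 + normc q33)).
move=> delta d0 d1.
have [x [y [w [x0 E yx wx]]]] := h delta d0.
have small u : normc u <= delta * normc x -> normc (u / x) <= delta.
  by move=> hu; rewrite Normc.normcM Normc.normcV ler_pdivrMr // normc_gt0.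
have prod u v : normc u <= delta -> normc v <= delta -> normc (u * v) <= delta.
  move=> hu hv; rewrite Normc.normcM -[delta]mulr1; apply: ler_pM; rewrite ?normc_ge0 //.
  exact: le_trans d1.
rewrite -normc_opp (_ : - q11 = q12 * (y / x) + q13 * (w / x) + q22 * (y / x * (y / x))
  + q23 * (y / x * (w / x)) + q33 * (w / x * (w / x))).
  by apply: normc_sum5; [exact: small|exact: small|apply: prod; exact: small..].
apply: (mulIf (expf_neq0 2 x0)); apply/eqP; rewrite -subr_eq0; apply/eqP.
rewrite -[RHS]oppr0 -[in RHS]E; field.
exact: x0.
Qed.

(** If moreover w is negligible against y, division by x y isolates the next
    coefficient: the quadric is tangent to w = 0 at the point y = w = 0. *)
Lemma dominant_coeffs2 (q12 q13 q22 q23 q33 : C) :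
  (forall delta : R, 0 < delta -> exists x y w : C,
    [/\ x != 0, y != 0,
     q12 * (x * y) + q13 * (x * w) + q22 * y ^+ 2
       + q23 * (y * w) + q33 * w ^+ 2 = 0,
     normc y <= delta * normc x & normc w <= delta * normc y]) ->
  q12 = 0.
Proof.
move=> h; apply: (@small_eq0 _ (normc q13 + normc q22 + normc q23 + normc q33 + normc 0)).
move=> delta d0 d1.
have [x [y [w [x0 y0 E yx wy]]]] := h delta d0.
have small u z : z != 0 -> normc u <= delta * normc z -> normc (u / z) <= delta.
  by move=> z0 hu; rewrite Normc.normcM Normc.normcV ler_pdivrMr // normc_gt0.
have prod u v : normc u <= delta -> normc v <= delta -> normc (u * v) <= delta.
  move=> hu hv; rewrite Normc.normcM -[delta]mulr1; apply: ler_pM; rewrite ?normc_ge0 //.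
  exact: le_trans d1.
rewrite -normc_opp (_ : - q12 = q13 * (w / y) + q22 * (y / x) + q23 * (w / y * (y / x))
  + q33 * (w / y * (w / y * (y / x))) + 0 * (y / x)).
  have hy := small _ _ x0 yx; have hw := small _ _ y0 wy; have hwy := prod _ _ hw hy.
  by apply: normc_sum5 => //; exact: prod.
apply: (mulIf (mulf_neq0 x0 y0)); apply/eqP; rewrite -subr_eq0; apply/eqP.
rewrite -[RHS]oppr0 -[in RHS]E; field.
by rewrite x0.
Qed.

End Asymptotics.

(** * Quadratic forms in coordinates adapted to four lines *)

Section Quadratic.
Variables (R : realType).
Local Notation C := R[i].

Lemma mpoly_quadratic n (F : mpoly n C) : F \is ishomog1 2 mdeg ->
  exists S : 'M[C]_n, F = \sum_c \sum_d
    S c d *: (mpolyX C (mnm1 c) * mpolyX C (mnm1 d)).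
Proof.
move=> /dhomogP hF.
pose isQ (G : mpoly n C) := exists S : 'M[C]_n, G = \sum_c \sum_d
    S c d *: (mpolyX C (mnm1 c) * mpolyX C (mnm1 d)).
rewrite -/(isQ F) [F]mpolyE big_seq; apply: (big_ind isQ).
- by exists 0; rewrite big1 // => c _; rewrite big1 // => d _; rewrite mxE scale0r.
- move=> _ _ [S ->] [S' ->]; exists (S + S').
  rewrite -big_split; apply: eq_bigr => c _; rewrite -big_split.
  by apply: eq_bigr => d _; rewrite mxE scalerDl.
- move=> m /hF /= m2.
  have [c mc] : exists c, (0 < m c)%N.
    apply/existsP; apply: contraT; rewrite negb_exists => /forallP h.
    by move: m2; rewrite mdegE big1 // => c _; have := h c; rewrite -eqn0Ngt => /eqP.
  have mE : m = mnm_add (mnm1 c) (mnm_sub m (mnm1 c)).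
    by rewrite addmC submK //; rewrite lep1mP -lt0n.
  have /eqP : mdeg (mnm_sub m (mnm1 c)) = 1%N.
    by move: m2; rewrite {1}mE mdegD mdeg1 => -[].
  rewrite mdeg_eq1 => /existsP [d /eqP dE].
  exists (mcoeff m F *: delta_mx c d).
  have -> : mpolyX C m = mpolyX C (mnm1 c) * mpolyX C (mnm1 d).
    by rewrite {1}mE dE mpolyXD.
  rewrite (bigD1 c) //= (bigD1 d) //= !mxE !eqxx mulr1.
  rewrite !big1 ?addr0 // => [c' cc'|d' dd']; last first.
    by rewrite !mxE (negPf dd') andbF mulr0 scale0r.
  by rewrite big1 // => d' _; rewrite !mxE (negPf cc') mulr0 scale0r.
Qed.

End Quadratic.

Section DualBasis.
Variable R : realType.
Local Notation C := R[i].
Implicit Types (X Y W u z p : 'rV[C]_3).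

Lemma lformDr u z z' : lform u (z + z') = lform u z + lform u z'.
Proof. by rewrite !lformE -big_split; apply: eq_bigr => c _; rewrite mxE mulrDr. Qed.

Lemma lformDl u v z : lform (u + v) z = lform u z + lform v z.
Proof. by rewrite !lformE -big_split; apply: eq_bigr => c _; rewrite mxE mulrDl. Qed.

Lemma lformBl u v z : lform (u - v) z = lform u z - lform v z.
Proof. by rewrite lformDl -scaleN1r lformZl mulN1r. Qed.

Lemma lform_eq0 u : (forall z, lform u z = 0) -> u = 0.
Proof. by move=> h; apply/rowP => c; rewrite -lform_delta h mxE. Qed.

Record dual_basis X Y W (e1 e2 e3 : 'rV[C]_3) : Prop := DualBasis {
  dual1 : [/\ lform X e1 = 1, lform Y e1 = 0 & lform W e1 = 0];
  dual2 : [/\ lform X e2 = 0, lform Y e2 = 1 & lform W e2 = 0];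
  dual3 : [/\ lform X e3 = 0, lform Y e3 = 0 & lform W e3 = 1];
  dual_span : forall z, z = lform X z *: e1 + lform Y z *: e2 + lform W z *: e3 }.

(** Three linear forms without common zero in the projective plane are linearly
    independent, so they are coordinates. *)
Lemma exists_dual_basis X Y W :
  proj_line X `&` proj_line Y `&` proj_line W = set0 ->
  exists e1 e2 e3, dual_basis X Y W e1 e2 e3.
Proof.
move=> h.
pose M : 'M[C]_3 := \matrix_(a < 3) [tuple X; Y; W]`_a.
have ME z (a : 'I_3) : (z *m M^T) 0 a = lform [tuple X; Y; W]`_a z.
  rewrite lformE mxE; apply: eq_bigr => c _; rewrite mulrC; congr (_ * _).
  by rewrite !mxE.
have Mu : M^T \in unitmx.
  rewrite unitmxE unitfE; apply/negP => /det0P [z z0 zM].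
  have : (proj_line X `&` proj_line Y `&` proj_line W) z.
    have H (a : 'I_3) : lform [tuple X; Y; W]`_a z = 0 by rewrite -ME zM mxE.
    by split; [split|]; split=> //; [exact: (H 0) | exact: (H 1) | exact: (H 2%:R)].
  by rewrite h.
pose e (a : 'I_3) : 'rV[C]_3 := delta_mx 0 a *m invmx M^T.
have eE (a b : 'I_3) : lform [tuple X; Y; W]`_b (e a) = (a == b)%:R.
  by rewrite -ME mulmxKV // mxE eq_sym.
exists (e 0), (e 1), (e 2%:R); split.
- by rewrite (eE 0 0) (eE 0 1) (eE 0 2%:R).
- by rewrite (eE 1 0) (eE 1 1) (eE 1 2%:R).
- by rewrite (eE 2%:R 0) (eE 2%:R 1) (eE 2%:R 2%:R).
move=> z; rewrite -{1}[z](mulmxK Mu) [z *m M^T]row_sum_delta mulmx_suml.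
by rewrite !big_ord_recl big_ord0 addr0 addrA -!scalemxAl !ME.
Qed.

(** The bilinear form gives access both to the values of F and to its
    differential, in any basis.  It is not required to be symmetric; a form with
    B z z = 0 for all z is alternating, and its polynomial is then zero. *)
Lemma quadratic_form_eval (F : mpoly 3 C) : F \is ishomog1 2 mdeg ->
  exists B : 'rV[C]_3 -> 'rV[C]_3 -> C,
  [/\ forall u v z, B (u + v) z = B u z + B v z,
      forall u v z, B z (u + v) = B z u + B z v,
      forall a u v, B (a *: u) v = a * B u v,
      forall a u v, B u (a *: v) = a * B u v &
      (forall z, meval (z 0) F = B z z) /\
      (forall p z, \sum_c meval (p 0) (mderiv c F) * z 0 c = B p z + B z p) /\
      ((forall z, B z z = 0) -> F = 0)].
Proof.
move=> /mpoly_quadratic [S FE].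
pose B (u v : 'rV[C]_3) := \sum_c \sum_d S c d * (u 0 c * v 0 d).
exists B; split.
- move=> u v z; rewrite /B -big_split; apply: eq_bigr => c _; rewrite -big_split.
  by apply: eq_bigr => d _; rewrite /= !mxE; ring.
- move=> u v z; rewrite /B -big_split; apply: eq_bigr => c _; rewrite -big_split.
  by apply: eq_bigr => d _; rewrite /= !mxE; ring.
- move=> a u v; rewrite /B mulr_sumr; apply: eq_bigr => c _; rewrite mulr_sumr.
  by apply: eq_bigr => d _; rewrite /= !mxE; ring.
- move=> a u v; rewrite /B mulr_sumr; apply: eq_bigr => c _; rewrite mulr_sumr.
  by apply: eq_bigr => d _; rewrite /= !mxE; ring.
split; [|split].
- move=> z; rewrite FE /B raddf_sum; apply: eq_bigr => c _; rewrite raddf_sum.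
  by apply: eq_bigr => d _; rewrite /= mevalZ mevalM !mevalXU.
- move=> p z.
  have dX (x y : 'I_3) : mderiv x (mpolyX C (mnm1 y)) = mpolyC 3 (y == x)%:R.
    rewrite mderivX mnmE; case: eqP => [->|_]; last by rewrite scale0r mpolyC0.
    rewrite scale1r (_ : mnm_sub _ _ = @mnm0 3) ?mpolyX0 //.
    by apply/mnmP => y'; rewrite mnmBE subnn mnm0E.
  have dF x : meval (p 0) (mderiv x F) =
      \sum_c \sum_d S c d * ((c == x)%:R * p 0 d + p 0 c * (d == x)%:R).
    rewrite FE (raddf_sum (mderiv x)) (raddf_sum (meval (p 0))); apply: eq_bigr => c _.
    rewrite (raddf_sum (mderiv x)) (raddf_sum (meval (p 0))); apply: eq_bigr => d _.
    by rewrite /= mderivZ mevalZ mderivM mevalD !mevalM !dX !mevalC !mevalXU.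
  under eq_bigr do rewrite dF mulr_suml.
  rewrite exchange_big /B -big_split; apply: eq_bigr => c _ /=.
  under eq_bigr do rewrite mulr_suml.
  rewrite exchange_big -big_split; apply: eq_bigr => d _ /=.
  rewrite (eq_bigr (fun x => S c d * p 0 d * ((c == x)%:R * z 0 x) +
     S c d * p 0 c * ((d == x)%:R * z 0 x))); last by move=> x _; ring.
  have pick (y : 'I_3) : \sum_x (y == x)%:R * z 0 x = z 0 y.
    rewrite (bigD1 y) //= eqxx mul1r big1 ?addr0 // => x /negPf yx.
    by rewrite eq_sym yx mul0r.
  by rewrite big_split /= -!mulr_sumr !pick; ring.
- move=> B0.
  have Bd (c d : 'I_3) : B (delta_mx 0 c) (delta_mx 0 d) = S c d.
    rewrite /B (bigD1 c) //= (bigD1 d) //= !mxE !eqxx !mulr1 !big1 ?addr0 //.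
      by move=> x /negPf xc; rewrite big1 // => y _; rewrite !mxE xc mul0r mulr0.
    by move=> y /negPf yd; rewrite !mxE yd !mulr0.
  have BD (u v : 'rV[C]_3) : B (u + v) (u + v) = B u u + B v v + (B u v + B v u).
    rewrite /B -!big_split; apply: eq_bigr => c _; rewrite -!big_split.
    by apply: eq_bigr => d _; rewrite !mxE /=; ring.
  have anti c d : S c d = - S d c.
    have := BD (delta_mx 0 c) (delta_mx 0 d); rewrite !B0 !Bd !add0r.
    by move/esym/eqP; rewrite addr_eq0 => /eqP.
  have FN : F = - F.
    rewrite {1}FE exchange_big [in RHS]FE -sumrN; apply: eq_bigr => d _.
    rewrite -sumrN; apply: eq_bigr => c _.
    by rewrite anti scaleNr [mpolyX _ _ * _]mulrC.
  have : 2%:R *: F = 0 by rewrite scaler_nat mulr2n {1}FN addNr.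
  by move/eqP; rewrite scaler_eq0 pnatr_eq0 /= => /eqP.
Qed.

End DualBasis.

Section NormalForm.
Variable R : realType.
Local Notation C := R[i].
Local Notation normc := (@ComplexField.Normc.normc R).
Implicit Types (X Y W L u z p fi fj fk fl : 'rV[C]_3) (F : mpoly 3 C).

(** In coordinates given by three of the lines, the fourth has three nonzero
    coefficients, because it avoids the three vertices; rescaling the
    coordinates makes it W - X - Y = 0. *)
Lemma four_lines_normal_form fi fj fk fl :
  proj_line fi `&` proj_line fj `&` proj_line fk = set0 ->
  proj_line fj `&` proj_line fk `&` proj_line fl = set0 ->
  proj_line fi `&` proj_line fk `&` proj_line fl = set0 ->
  proj_line fi `&` proj_line fj `&` proj_line fl = set0 ->
  exists alpha beta gamma, [/\ alpha != 0, beta != 0, gamma != 0 &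
    forall z, lform fl z =
      lform (gamma *: fk) z - lform (alpha *: fi) z - lform (beta *: fj) z].
Proof.
move=> ijk jkl ikl ijl.
have [e1 [e2 [e3 [[X1 Y1 W1] [X2 Y2 W2] [X3 Y3 W3] sp]]]] := exists_dual_basis ijk.
have flE z : lform fl z = lform fi z * lform fl e1 + lform fj z * lform fl e2
    + lform fk z * lform fl e3 by rewrite {1}[z]sp !lformDr !lformZr.
have nz u e : lform u e = 1 -> e != 0.
  by apply: contra_eqN => /eqP ->; rewrite lform0r eq_sym oner_eq0.
exists (- lform fl e1), (- lform fl e2), (lform fl e3); split.
- rewrite oppr_eq0; apply: contra_eqN jkl => /eqP E; apply/eqP => /seteqP [+ _].
  have e10 := nz _ _ X1.
  by move=> /(_ e1); apply; split; [split|]; split.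
- rewrite oppr_eq0; apply: contra_eqN ikl => /eqP E; apply/eqP => /seteqP [+ _].
  have e20 := nz _ _ Y2.
  by move=> /(_ e2); apply; split; [split|]; split.
- apply: contra_eqN ijl => /eqP E; apply/eqP => /seteqP [+ _].
  have e30 := nz _ _ W3.
  by move=> /(_ e3); apply; split; [split|]; split.
- by move=> z; rewrite flE !lformZl; ring.
Qed.

Lemma quadratic_expansion F X Y W e1 e2 e3 : F \is ishomog1 2 mdeg ->
  dual_basis X Y W e1 e2 e3 ->
  exists q11 q12 q13 q22 q23 q33, [/\
    forall z : 'rV[C]_3, meval (z 0) F =
      q11 * lform X z ^+ 2 + q12 * (lform X z * lform Y z)
      + q13 * (lform X z * lform W z) + q22 * lform Y z ^+ 2
      + q23 * (lform Y z * lform W z) + q33 * lform W z ^+ 2,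
    forall z, \sum_c meval (e3 0) (mderiv c F) * z 0 c =
      q13 * lform X z + q23 * lform Y z + 2 * q33 * lform W z &
    (forall z : 'rV[C]_3, meval (z 0) F = 0) -> F = 0].
Proof.
move=> Fh [_ _ _ sp].
have [B [BDl BDr BZl BZr [FB [dFB B0]]]] := quadratic_form_eval Fh.
exists (B e1 e1), (B e1 e2 + B e2 e1), (B e1 e3 + B e3 e1), (B e2 e2),
  (B e2 e3 + B e3 e2), (B e3 e3).
split=> [z|z|F0]; last by apply: B0 => z; rewrite -FB.
  by rewrite FB {1 2}[z]sp !(BDl, BDr, BZl, BZr); ring.
by rewrite dFB {1 2}[z]sp !(BDl, BDr, BZl, BZr); ring.
Qed.

(** The curve F = 0 has points tending to the point v = w = 0, faster towards the
    line w = 0 than towards v = 0. *)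
Definition flag_approached F u v w := forall delta : R, 0 < delta ->
  exists z : 'rV[C]_3, [/\ meval (z 0) F = 0, lform u z != 0, lform v z != 0,
    normc (lform v z) <= delta * normc (lform u z) &
    normc (lform w z) <= delta * normc (lform v z) /\
    normc (lform w z) <= delta * normc (lform u z)].

(** The curve F = 0 has points tending to the point v = w = 0. *)
Definition point_approached F u v w := forall delta : R, 0 < delta ->
  exists z : 'rV[C]_3, [/\ meval (z 0) F = 0, lform u z != 0,
    normc (lform v z) <= delta * normc (lform u z) &
    normc (lform w z) <= delta * normc (lform u z)].

(** The conic passes through X = W = 0 tangent to W = 0, through Y = L = 0 tangent
    to L = 0, and through X = Y = 0.  These are five linear conditions on its six
    coefficients, two for each tangency. *)
Lemma conic_equation F X Y W L e1 e2 e3 : F \is ishomog1 2 mdeg -> F != 0 ->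
  dual_basis X Y W e1 e2 e3 ->
  (forall z, lform L z = lform W z - lform X z - lform Y z) ->
  flag_approached F Y X W -> flag_approached F X Y L -> point_approached F W X Y ->
  exists q, [/\ q != 0,
    forall z : 'rV[C]_3, meval (z 0) F =
      q * (lform X z ^+ 2 - lform X z * lform W z + lform Y z * lform W z) &
    forall z, \sum_c meval (e3 0) (mderiv c F) * z 0 c = q * (lform Y z - lform X z)].
Proof.
move=> Fh F0 dual LE dYXW dXYL dWXY.
have [q11 [q12 [q13 [q22 [q23 [q33 [Fz dF Fnz]]]]]]] := quadratic_expansion Fh dual.
have WE z : lform W z = lform X z + lform Y z + lform L z by rewrite LE; ring.
have q22_0 : q22 = 0.
  apply: (@dominant_coeffs _ q22 q12 q23 q11 q13 q33) => delta d0.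
  have [z [z0 Y0 _ xy [_ wy]]] := dYXW _ d0.
  exists (lform Y z), (lform X z), (lform W z); split=> //.
  by rewrite -[RHS]z0 Fz; ring.
have q12_0 : q12 = 0.
  apply: (@dominant_coeffs2 _ q12 q23 q11 q13 q33) => delta d0.
  have [z [z0 Y0 X0 xy [wx _]]] := dYXW _ d0.
  exists (lform Y z), (lform X z), (lform W z); split=> //.
  by rewrite -[RHS]z0 Fz q22_0; ring.
have q33_0 : q33 = 0.
  apply: (@dominant_coeffs _ q33 q13 q23 q11 q12 q22) => delta d0.
  have [z [z0 W0 xw yw]] := dWXY _ d0.
  exists (lform W z), (lform X z), (lform Y z); split=> //.
  by rewrite -[RHS]z0 Fz; ring.
have q13E : q11 + q13 = 0.
  apply: (@dominant_coeffs _ _ (q13 + q23) q13 q23 q23 0) => delta d0.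
  have [z [z0 X0 _ yx [_ lx]]] := dXYL _ d0.
  exists (lform X z), (lform Y z), (lform L z); split=> //.
  by rewrite -[RHS]z0 Fz q22_0 q12_0 q33_0 WE; ring.
have {}q13E : q13 = - q11 by apply/eqP; rewrite -addr_eq0 addrC q13E.
have q23E : q13 + q23 = 0.
  apply: (@dominant_coeffs2 _ _ q13 q23 q23 0) => delta d0.
  have [z [z0 X0 Y0 yx [ly _]]] := dXYL _ d0.
  exists (lform X z), (lform Y z), (lform L z); split=> //.
  by rewrite -[RHS]z0 Fz q22_0 q12_0 q33_0 WE q13E; ring.
have {}q23E : q23 = q11 by apply: (addrI q13); rewrite q23E q13E addNr.
have {}Fz (z : 'rV[C]_3) : meval (z 0) F =
    q11 * (lform X z ^+ 2 - lform X z * lform W z + lform Y z * lform W z).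
  by rewrite Fz q22_0 q12_0 q33_0 q13E q23E; ring.
exists q11; split=> [||z]; [|exact: Fz|by rewrite dF q13E q23E q33_0; ring].
apply: contraNneq F0 => E; apply/eqP/Fnz => z.
by rewrite Fz E mul0r.
Qed.

(** The equation X^2 - X W + Y W = 0 reads X : Y : W = s(s - t) : t(s - t) : s^2
    with s = W and t = W - X. *)
Lemma conic_parametrization F X Y W e1 e2 e3 q : q != 0 ->
  dual_basis X Y W e1 e2 e3 ->
  (forall z : 'rV[C]_3, meval (z 0) F =
      q * (lform X z ^+ 2 - lform X z * lform W z + lform Y z * lform W z)) ->
  exists zeta : C -> C -> 'rV[C]_3, [/\
    forall s t, meval (zeta s t 0) F = 0,
    forall z : 'rV[C]_3, meval (z 0) F = 0 -> lform W z != 0 ->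
      exists s t lam, lam != 0 /\ z = lam *: zeta s t &
    forall s t, [/\ lform X (zeta s t) = s * (s - t),
      lform Y (zeta s t) = t * (s - t) & lform W (zeta s t) = s ^+ 2]].
Proof.
move=> q0 [[X1 Y1 W1] [X2 Y2 W2] [X3 Y3 W3] sp] Fz.
pose zeta s t : 'rV[C]_3 := (s * (s - t)) *: e1 + (t * (s - t)) *: e2 + (s ^+ 2) *: e3.
have zX s t : lform X (zeta s t) = s * (s - t).
  by rewrite !lformDr !lformZr X1 X2 X3; ring.
have zY s t : lform Y (zeta s t) = t * (s - t).
  by rewrite !lformDr !lformZr Y1 Y2 Y3; ring.
have zW s t : lform W (zeta s t) = s ^+ 2.
  by rewrite !lformDr !lformZr W1 W2 W3; ring.
exists zeta; split=> // [s t|z]; first by rewrite Fz zX zY zW; ring.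
rewrite Fz => /eqP; rewrite mulf_eq0 (negPf q0) /= => /eqP Q w0.
exists (lform W z), (lform W z - lform X z), (lform W z)^-1.
split; first by rewrite invr_eq0.
rewrite {1}[z]sp /zeta !scalerDr !scalerA.
congr (_ *: _ + _ *: _ + _ *: _).
- by rewrite opprB addrC subrK mulKf.
- apply: (mulfI w0); rewrite mulVKf //.
  by apply/eqP; rewrite -subr_eq0 -[X in _ == X]Q; apply/eqP; ring.
- by rewrite expr2 mulKf.
Qed.

End NormalForm.

(** * The conic of the hypothesis and the lines m and n *)

Section Conic.
Variable R : realType.
Local Notation C := R[i].
Local Notation normc := (@ComplexField.Normc.normc R).
Variables (f : 'I_4 -> 'rV[C]_3) (i j k l : 'I_4) (F : mpoly 3 C).
Hypothesis ijkl : uniq [:: i; j; k; l].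
Hypothesis uni : uniform f.
Hypothesis Fh : F \is ishomog1 2 mdeg.
Hypothesis F0 : F != 0.
Hypothesis rays : Log_cvg (plane_curve f F) (Defs.support R
    [:: (uvec i + uvec k *+ 2, 1%N);
        (uvec j + uvec l *+ 2, 1%N);
        (uvec i + uvec j, 1%N)]).

Definition conic_parametrized (zeta : C -> C -> 'rV[C]_3) (fm fn : 'rV[C]_3) :=
  [/\ forall s t, meval (zeta s t 0) F = 0,
      forall z : 'rV[C]_3, meval (z 0) F = 0 -> lform (f k) z != 0 ->
        exists s t lam, lam != 0 /\ z = lam *: zeta s t,
      [/\ cuts zeta (f i) 1 1 0, cuts zeta (f j) 0 1 1, cuts zeta (f k) 2 0 0 &
          cuts zeta (f l) 0 0 2] &
      cuts zeta fm 1 0 1 /\ cuts zeta fn 0 2 0].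

(** Rescaling each form by a nonzero constant changes the ratios by at most the
    bounded factor M m. *)
Lemma conic_ray_dominance (v : 'I_4 -> nat) (c : 'I_4 -> C) :
  (forall r, c r != 0) ->
  (exists2 e, e \in [:: (uvec i + uvec k *+ 2, 1%N); (uvec j + uvec l *+ 2, 1%N);
        (uvec i + uvec j, 1%N)] & e.1 = ray v) ->
  forall delta : R, 0 < delta -> exists z, [/\ off_lines f z, meval (z 0) F = 0 &
    forall r s, (v r < v s)%N ->
      normc (lform (c s *: f s) z) <= delta * normc (lform (c r *: f r) z)].
Proof.
move=> c0 [e es eE] delta d0.
have hray : Log_liminf (plane_curve f F) (map_mx intr (ray v)).
  by have [-> _] := rays; exists e, 1; rewrite scale1r eE.
have n0 r : 0 < normc (c r) by rewrite normc_gt0.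
pose M := \sum_r normc (c r); pose m := \sum_r (normc (c r))^-1.
have cM r : normc (c r) <= M.
  by rewrite /M (bigD1 r) //= lerDl sumr_ge0 // => *; exact: ltW.
have cm r : (normc (c r))^-1 <= m.
  by rewrite /m (bigD1 r) //= lerDl sumr_ge0 // => *; rewrite invr_ge0 ltW.
have M0 : 0 < M := lt_le_trans (n0 i) (cM i).
have m0 : 0 < m by apply: lt_le_trans (cm i); rewrite invr_gt0.
have [|z [zoff Fz zd]] := ray_dominance hray (delta := delta / (M * m)).
  by rewrite divr_gt0 ?mulr_gt0.
exists z; split=> // r s /zd {}zd.
have f0 u : 0 <= normc (lform u z) by rewrite normc_ge0.
rewrite !lformZl !Normc.normcM.
apply: (@le_trans _ _ (M * (delta / (M * m) * normc (lform (f r) z)))).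
  by apply: ler_pM => //; exact: ltW.
rewrite (_ : _ * _ = m^-1 * (delta * normc (lform (f r) z))); last first.
  by field; rewrite !gt_eqF.
have mc : m^-1 <= normc (c r).
  by rewrite -[normc _]invrK lef_pV2 ?posrE ?invr_gt0.
by rewrite mulrCA ler_wpM2l ?ler_wpM2r // ltW.
Qed.

(** In the coordinates of the normal form the line through X = W = 0 and
    Y = L = 0 is W - X = 0, which restricts to s t on the conic, and the tangent
    at X = Y = 0 is Y - X = 0, which restricts to - (s - t)^2. *)
Lemma conic_param_exists (fm fn : 'rV[C]_3) :
  fm != 0 ->
  proj_line (f i) `&` proj_line (f k) `<=` proj_line fm ->
  proj_line (f j) `&` proj_line (f l) `<=` proj_line fm ->
  (forall p, (proj_line (f i) `&` proj_line (f j)) p -> tangent_line F fn p) ->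
  exists zeta, conic_parametrized zeta fm fn.
Proof.
move=> fm0 ikm jlm ijn.
have [ij ik il jk /andP[jl kl]] : [/\ i != j, i != k, i != l, j != k & (j != l) && (k != l)].
  by move: ijkl; rewrite /= !inE !negb_or => /and4P [/and3P [-> -> ->] /andP[-> ->] -> _].
have ijk : proj_line (f i) `&` proj_line (f j) `&` proj_line (f k) = set0.
  by apply: uni; rewrite /= !inE !negb_or ij ik jk.
have [al [be [ga [al0 be0 ga0 flE]]]] : exists alpha beta gamma,
    [/\ alpha != 0, beta != 0, gamma != 0 & forall z, lform (f l) z =
      lform (gamma *: f k) z - lform (alpha *: f i) z - lform (beta *: f j) z].
  apply: four_lines_normal_form ijk _ _ _; apply: uni;
  by rewrite /= !inE !negb_or ?ij ?ik ?il ?jk ?jl ?kl.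
have lineE u (c : C) : c != 0 -> proj_line (c *: u) = proj_line u.
  move=> c0; apply/seteqP; split=> z [z0 /eqP]; rewrite ?lformZl => h; split=> //.
    by move: h; rewrite mulf_eq0 (negPf c0) => /eqP.
  by rewrite lformZl (eqP h) mulr0.
pose c r := if r == i then al else if r == j then be else if r == k then ga else 1.
have c0 r : c r != 0 by rewrite /c; do 3?[case: ifP => // _]; exact: oner_neq0.
have eqE := (eqxx, negPf ij, negPf ik, negPf il, negPf jk, negPf jl, negPf kl,
  eq_sym j i, eq_sym k i, eq_sym l i, eq_sym k j, eq_sym l j, eq_sym l k).
have ci : c i = al by rewrite /c !eqE.
have cj : c j = be by rewrite /c !eqE.
have ck : c k = ga by rewrite /c !eqE.
have cl : c l = 1 by rewrite /c !eqE.
have offE z r : off_lines f z -> lform (c r *: f r) z != 0.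
  by move=> zoff; rewrite lformZl mulf_neq0.
have [X [Y [W [XE YE WE]]]] : exists X Y W, [/\ X = al *: f i, Y = be *: f j & W = ga *: f k].
  by do 3 eexists.
rewrite -XE -YE -WE in flE.
have dik : flag_approached F Y X W.
  pose v (r : 'I_4) := ((r == i) + (r == k) * 2)%N.
  move=> delta d0; have [|z [zoff z0 h]] := @conic_ray_dominance v c c0 _ delta d0.
    exists (uvec i + uvec k *+ 2, 1%N); first by rewrite !inE eqxx.
    by rewrite !uvec_ray ray_double rayD.
  have := h j i; have := h i k; have := h j k.
  have := offE z j zoff; have := offE z i zoff.
  rewrite /v ci cj ck -XE -YE -WE !eqE => X0 Y0 hjk hik hji.
  by exists z; split; rewrite ?hji ?hik ?hjk.
have djl : flag_approached F X Y (f l).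
  pose v (r : 'I_4) := ((r == j) + (r == l) * 2)%N.
  move=> delta d0; have [|z [zoff z0 h]] := @conic_ray_dominance v c c0 _ delta d0.
    exists (uvec j + uvec l *+ 2, 1%N); first by rewrite !inE eqxx orbT.
    by rewrite !uvec_ray ray_double rayD.
  have := h i j; have := h j l; have := h i l.
  have := offE z j zoff; have := offE z i zoff.
  rewrite /v ci cj cl -XE -YE scale1r !eqE => X0 Y0 hil hjl hij.
  by exists z; split; rewrite ?hij ?hjl ?hil.
have dij : point_approached F W X Y.
  pose v (r : 'I_4) := ((r == i) + (r == j))%N.
  move=> delta d0; have [|z [zoff z0 h]] := @conic_ray_dominance v c c0 _ delta d0.
    exists (uvec i + uvec j, 1%N); first by rewrite !inE eqxx !orbT.
    by rewrite !uvec_ray rayD.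
  have := h k i; have := h k j; have := offE z k zoff.
  rewrite /v ci cj ck -XE -YE -WE !eqE => W0 hkj hki.
  by exists z; split; rewrite ?hki ?hkj.
have XYW : proj_line X `&` proj_line Y `&` proj_line W = set0.
  by rewrite XE YE WE !lineE.
have [e1 [e2 [e3 dual]]] := exists_dual_basis XYW.
have [q [q0 Fz dF]] := conic_equation Fh F0 dual flE dik djl dij.
have [zeta [zF zsurj zE]] := conic_parametrization q0 dual Fz.
have [[X1 Y1 W1] [X2 Y2 W2] [X3 Y3 W3] sp] := dual.
have unscale (d : C) u m n o : d != 0 -> (forall s t, lform (d *: u) (zeta s t) =
    s ^+ m * (s - t) ^+ n * t ^+ o) -> cuts zeta u m n o.
  move=> d0 h; exists d^-1; first by rewrite invr_eq0.
  by move=> s t; rewrite -h lformZl mulKf.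
have nz (u e : 'rV[C]_3) : lform u e = 1 -> e != 0.
  by apply: contra_eqN => /eqP ->; rewrite lform0r eq_sym oner_eq0.
have iX : proj_line (f i) = proj_line X by rewrite XE lineE.
have jY : proj_line (f j) = proj_line Y by rewrite YE lineE.
have kW : proj_line (f k) = proj_line W by rewrite WE lineE.
exists zeta; split=> //.
- by move=> z z0 kz; apply: zsurj; rewrite // WE lformZl mulf_neq0.
- split.
  + by apply: (unscale al) => // s t; have [zX _ _] := zE s t; rewrite -XE zX; ring.
  + by apply: (unscale be) => // s t; have [_ zY _] := zE s t; rewrite -YE zY; ring.
  + by apply: (unscale ga) => // s t; have [_ _ zW] := zE s t; rewrite -WE zW; ring.
  + apply: (unscale 1); rewrite ?oner_neq0 // scale1r => s t.
    by have [zX zY zW] := zE s t; rewrite flE zX zY zW; ring.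
- split.
  + have m2 : lform fm e2 = 0.
      have [] // : proj_line fm e2.
      by apply: ikm; rewrite iX kW; split; split; rewrite ?(nz _ _ Y2).
    have m13 : lform fm e3 = - lform fm e1.
      have [] // : proj_line fm (e1 + e3).
        have e130 : e1 + e3 != 0 by apply: (nz W); rewrite lformDr W1 W3 add0r.
        apply: jlm; rewrite jY; split; split=> //; rewrite ?flE !lformDr.
          by rewrite Y1 Y3 addr0.
        by rewrite X1 Y1 W1 X3 Y3 W3; ring.
      by move=> _ /eqP; rewrite lformDr addrC addr_eq0 => /eqP.
    have fmE z : lform fm z = lform fm e3 * (lform W z - lform X z).
      by rewrite {1}[z]sp !lformDr !lformZr m2 m13; ring.
    exists (lform fm e3).
      apply: contra_neq fm0 => E; apply: lform_eq0 => z.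
      by rewrite fmE E mul0r.
    by move=> s t; have [zX _ zW] := zE s t; rewrite fmE zX zW; ring.
  + have [fn0 _ _ tan] : tangent_line F fn e3.
      by apply: ijn; rewrite iX jY; split; split; rewrite ?(nz _ _ W3).
    have [d dE] : exists d, Y - X = d *: fn.
      apply: lform_coeff => // z fnz.
      have [->|z0] := eqVneq z 0; first exact: lform0r.
      have := tan z (conj z0 fnz); rewrite dF => /eqP.
      by rewrite mulf_eq0 (negPf q0) lformBl => /eqP.
    have d0 : d != 0.
      apply: contra_eqN Y2 => /eqP d0; have := congr1 (fun u => lform u e2) dE.
      rewrite d0 scale0r lformBl X2 subr0 => ->.
      by rewrite /lform mul0mx mxE eq_sym oner_eq0.
    apply: (unscale (- d)); rewrite ?oppr_eq0 // => s t.
    have [zX zY _] := zE s t.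
    by rewrite scaleNr -dE opprB lformBl zX zY; ring.
Qed.

End Conic.

(** * Assembling a plane from a table of exponents *)

Section ExponentTable.
Variables (R : realType) (N : nat).
Local Notation C := R[i].
Implicit Types (s : seq 'I_N.+1) (w : seq nat).

(** A function on the lines given by listing the lines and, in parallel, the
    values.  This lets the conditions on the exponents be checked by evaluation
    on lists. *)
Definition entry s w (r : 'I_N.+1) := nth 0%N w (index r s).

Lemma uniq_size_mem s : uniq s -> size s = N.+1 -> forall r, r \in s.
Proof.
move=> us ss r.
have sub : {subset s <= enum 'I_N.+1} by move=> x _; rewrite mem_enum.
have le : (size (enum 'I_N.+1) <= size s)%N by rewrite size_enum_ord ss.
by have [_ ->] := uniq_min_size us sub le; rewrite mem_enum.
Qed.

Lemma ray_sum (a : 'I_N.+1 -> nat) : ray a = \sum_r uvec r *+ a r.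
Proof.
apply/rowP => x; rewrite summxE mxE.
have pick (y : 'I_N.+1) : (a y)%:Z = \sum_r ((y == r)%:Z * (a r)%:Z).
  rewrite (bigD1 y) //= eqxx mul1r big1 ?addr0 // => r /negPf ry.
  by rewrite eq_sym ry mul0r.
rewrite (pick ord0) (pick (lift ord0 x)) -sumrB; apply: eq_bigr => r _.
by rewrite uvec_ray -mulrBl mulmxnE mxE -mulr_natr natz.
Qed.

Lemma ray_entry s w : uniq s -> size s = N.+1 ->
  ray (entry s w) = \sum_(0 <= n < N.+1) uvec (nth ord0 s n) *+ nth 0%N w n.
Proof.
move=> us ss; rewrite ray_sum.
transitivity (\sum_(r <- s) uvec r *+ entry s w r).
  rewrite [RHS]big_uniq //; apply: eq_bigl => r.
  by rewrite (uniq_size_mem us ss).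
rewrite (big_nth ord0) ss !big_mkord; apply: eq_bigr => n _.
by rewrite /entry index_uniq // ss.
Qed.

End ExponentTable.

Section FineApproximation.
Variables (R : realType).
Local Notation C := R[i].
Variables (f : 'I_4 -> 'rV[C]_3) (i j k l : 'I_4) (F : mpoly 3 C).
Variables (fm fn : 'rV[C]_3) (zeta : C -> C -> 'rV[C]_3).
Hypothesis param : conic_parametrized f i j k l F zeta fm fn.
Hypothesis Fh : F \is ishomog1 2 mdeg.
Hypothesis Firr : irreducible_mpoly F.
Hypothesis ijk : proj_line (f i) `&` proj_line (f j) `&` proj_line (f k) = set0.

Lemma zeta_neq0 s t : s != 0 \/ t != 0 -> zeta s t != 0.
Proof.
have [_ _ [_ _ [ck ck0 hk] [cl cl0 hl]] _] := param => st.
apply/eqP => z0; case: st => /eqP; apply; apply/eqP.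
  have := hk s t; rewrite z0 lform0r => /esym/eqP.
  by rewrite !expr0 !mulr1 mulf_eq0 (negPf ck0) expf_eq0.
have := hl s t; rewrite z0 lform0r => /esym/eqP.
by rewrite !expr0 !mul1r mulf_eq0 (negPf cl0) expf_eq0.
Qed.

(** All three planes at once: the lists s, a, b, e describe the added lines and
    their exponents at the three points.  An added line must not meet the conic
    with multiplicity 1 at the point (i, j), as i and j do, for otherwise the
    minor provided by i, j and this line would vanish. *)
Lemma conic_fine_approximation N (g : 'I_N.+1 -> 'rV[C]_3) (i' j' k' l' : 'I_N.+1)
    (s : seq 'I_N.+1) (a b e : seq nat)
    (s4 := [:: i', j', k', l' & s]) (a4 := [:: 1, 0, 2, 0 & a]%N)
    (b4 := [:: 1, 1, 0, 0 & b]%N) (e4 := [:: 0, 1, 0, 2 & e]%N) :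
  uniq s4 -> size s4 = N.+1 ->
  [/\ proj_line (g i') = proj_line (f i), proj_line (g j') = proj_line (f j),
      proj_line (g k') = proj_line (f k) & proj_line (g l') = proj_line (f l)] ->
  (forall n, (n < size s)%N -> cuts zeta (g (nth ord0 s n))
      (nth 0%N a n) (nth 0%N b n) (nth 0%N e n)) ->
  (forall n, (n < size s)%N -> (nth 0%N a n + nth 0%N b n + nth 0%N e n)%N = 2%N
     /\ nth 0%N b n != 1%N) ->
  (forall n n', (n < size s4)%N -> (n' < size s4)%N ->
     nth 0%N a4 n = nth 0%N a4 n' -> nth 0%N b4 n = nth 0%N b4 n' -> n = n') ->
  line_arrangement g /\ finely_approximable g
    [:: (\sum_(0 <= n < N.+1) uvec (nth ord0 s4 n) *+ nth 0%N b4 n, 1%N);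
        (\sum_(0 <= n < N.+1) uvec (nth ord0 s4 n) *+ nth 0%N a4 n, 1%N);
        (\sum_(0 <= n < N.+1) uvec (nth ord0 s4 n) *+ nth 0%N e4 n, 1%N)].
Proof.
move=> us ss [gi gj gk gl] scut stab inj4.
have [Fz Fsurj [ci cj ck cl] _] := param.
have mem4 := uniq_size_mem us ss.
have idx r : exists2 n, (n < size s4)%N & r = nth ord0 s4 n.
  by exists (index r s4); rewrite ?index_mem ?nth_index.
have entryE w n : (n < size s4)%N -> entry s4 w (nth ord0 s4 n) = nth 0%N w n.
  by move=> ns; rewrite /entry index_uniq.
have cut4 r : cuts zeta (g r) (entry s4 a4 r) (entry s4 b4 r) (entry s4 e4 r).
  have [n ns ->] := idx r; rewrite !entryE //.
  move: n ns => [|[|[|[|n]]]] ns /=; [| | | |exact: scut];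
    [apply: cuts_proj_line ci|apply: cuts_proj_line cj|
     apply: cuts_proj_line ck|apply: cuts_proj_line cl] => //.
have sum4 r : (entry s4 a4 r + entry s4 b4 r + entry s4 e4 r = 2)%N.
  have [n ns ->] := idx r; rewrite !entryE //.
  by move: n ns => [|[|[|[|n]]]] ns //=; have [] := stab n ns.
have b02 r : [\/ r = i', r = j', entry s4 b4 r = 0%N | entry s4 b4 r = 2%N].
  have := sum4 r; have [n ns ->] := idx r; rewrite !entryE //.
  move: n ns => [|[|[|[|n]]]] ns //= S.
  - by constructor 1.
  - by constructor 2.
  - by constructor 3.
  - by constructor 3.
  have [_ b1] := stab n ns.
  move: S b1; case: (nth 0%N b n) => [|[|[|m]]] // S _; [constructor 3|constructor 4|] => //.
  by exfalso; lia.
have inj r r' : entry s4 a4 r = entry s4 a4 r' -> entry s4 b4 r = entry s4 b4 r' -> r = r'.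
  have [n ns ->] := idx r; have [n' ns' ->] := idx r'; rewrite !entryE //.
  by move=> h1 h2; rewrite (inj4 n n').
have at_ w n : (n < 4)%N -> entry s4 w (nth ord0 s4 n) = nth 0%N w n.
  by move=> n4; apply: entryE; rewrite (leq_trans n4).
split.
  apply: (line_arrangement_cuts (i := i') (j := j') (k := k') zeta_neq0 cut4 sum4 inj).
  by rewrite gi gj gk; exact: ijk.
rewrite -!ray_entry //.
apply: (finely_approximable_cuts Fh Firr Fz _ cut4 sum4 _ _ _ _ b02 (k := k') (l := l')).
- move=> z Fz0 kz; apply: Fsurj => //.
  have [d d0 dE] := proj_line_eq (cuts_neq0 ck) gk.
  by move: kz; rewrite dE lformZl mulf_eq0 negb_or d0.
- by rewrite (at_ _ 0) // (at_ _ 0).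
- by rewrite (at_ _ 1) // (at_ _ 1).
- by rewrite (at_ _ 2) // (at_ _ 2).
- by rewrite (at_ _ 3) // (at_ _ 3).
Qed.

End FineApproximation.

Theorem lemma6p8 (R : realType) (f : 'I_4 -> 'rV[R[i]]_3) (i j k l : 'I_4)
    (F : mpoly 3 R[i]) (fm fn : 'rV[R[i]]_3) :
  uniq [:: i; j; k; l] ->
  line_arrangement f ->
  uniform f ->
  (* the curve C_2 *)
  finely_approximates f 2 F
    [:: (uvec i + uvec k *+ 2, 1%N);
        (uvec j + uvec l *+ 2, 1%N);
        (uvec i + uvec j, 1%N)] ->
  (* the lines L_m and L_n *)
  fm != 0 ->
  proj_line (f i) `&` proj_line (f k) `<=` proj_line fm ->
  proj_line (f j) `&` proj_line (f l) `<=` proj_line fm ->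
  (forall p, (proj_line (f i) `&` proj_line (f j)) p -> tangent_line F fn p) ->
  [/\ forall (g : 'I_5 -> 'rV[R[i]]_3) (i' j' k' l' m' : 'I_5),
        uniq [:: i'; j'; k'; l'; m'] ->
        [/\ proj_line (g i') = proj_line (f i),
            proj_line (g j') = proj_line (f j),
            proj_line (g k') = proj_line (f k),
            proj_line (g l') = proj_line (f l) &
            proj_line (g m') = proj_line fm] ->
        line_arrangement g /\
        finely_approximable g
          [:: (uvec i' + uvec j', 1%N);
              (uvec i' + uvec k' *+ 2 + uvec m', 1%N);
              (uvec j' + uvec l' *+ 2 + uvec m', 1%N)],
      forall (g : 'I_5 -> 'rV[R[i]]_3) (i' j' k' l' n' : 'I_5),
        uniq [:: i'; j'; k'; l'; n'] ->
        [/\ proj_line (g i') = proj_line (f i),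
            proj_line (g j') = proj_line (f j),
            proj_line (g k') = proj_line (f k),
            proj_line (g l') = proj_line (f l) &
            proj_line (g n') = proj_line fn] ->
        line_arrangement g /\
        finely_approximable g
          [:: (uvec i' + uvec j' + uvec n' *+ 2, 1%N);
              (uvec i' + uvec k' *+ 2, 1%N);
              (uvec j' + uvec l' *+ 2, 1%N)] &
      forall (g : 'I_6 -> 'rV[R[i]]_3) (i' j' k' l' m' n' : 'I_6),
        uniq [:: i'; j'; k'; l'; m'; n'] ->
        [/\ proj_line (g i') = proj_line (f i),
            proj_line (g j') = proj_line (f j),
            proj_line (g k') = proj_line (f k) &
            proj_line (g l') = proj_line (f l)] ->
        proj_line (g m') = proj_line fm ->
        proj_line (g n') = proj_line fn ->
        line_arrangement g /\
        finely_approximable g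
          [:: (uvec i' + uvec j' + uvec n' *+ 2, 1%N);
              (uvec i' + uvec k' *+ 2 + uvec m', 1%N);
              (uvec j' + uvec l' *+ 2 + uvec m', 1%N)]].
Proof.
move=> ijkl _ uni [_ _ [Fh Firr] _ [rays _]] fm0 ikm jlm ijn.
have [F0 _ _] := Firr.
have [zeta par] := conic_param_exists ijkl uni Fh F0 rays fm0 ikm jlm ijn.
have [_ _ _ [cm cn]] := par.
have ijk : proj_line (f i) `&` proj_line (f j) `&` proj_line (f k) = set0.
  by apply: uni; move: ijkl; rewrite /= !inE !negb_or => /and4P[/and3P[-> -> _] /andP[-> _] _ _].
split.
- move=> g i' j' k' l' m' us [gi gj gk gl gm].
  have := @conic_fine_approximation _ _ _ _ _ _ _ _ _ _ par Fh Firr ijk _ g i' j' k' l'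
    [:: m'] [:: 1%N] [:: 0%N] [:: 1%N] us erefl (And4 gi gj gk gl).
  rewrite !big_mkord !big_ord_recl !big_ord0 /= !(mulr1n, mulr0n, addr0, add0r, addrA).
  apply.
  + by move=> [|n] // _; exact: cuts_proj_line cm.
  + by move=> [|n].
  + by move=> [|[|[|[|[|n]]]]] [|[|[|[|[|n']]]]].
- move=> g i' j' k' l' n' us [gi gj gk gl gn].
  have := @conic_fine_approximation _ _ _ _ _ _ _ _ _ _ par Fh Firr ijk _ g i' j' k' l'
    [:: n'] [:: 0%N] [:: 2%N] [:: 0%N] us erefl (And4 gi gj gk gl).
  rewrite !big_mkord !big_ord_recl !big_ord0 /= !(mulr1n, mulr0n, addr0, add0r, addrA).
  apply.
  + by move=> [|n] // _; exact: cuts_proj_line cn.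
  + by move=> [|n].
  + by move=> [|[|[|[|[|n]]]]] [|[|[|[|[|n'']]]]].
- move=> g i' j' k' l' m' n' us [gi gj gk gl] gm gn.
  have := @conic_fine_approximation _ _ _ _ _ _ _ _ _ _ par Fh Firr ijk _ g i' j' k' l'
    [:: m'; n'] [:: 1; 0]%N [:: 0; 2]%N [:: 1; 0]%N us erefl (And4 gi gj gk gl).
  rewrite !big_mkord !big_ord_recl !big_ord0 /= !(mulr1n, mulr0n, addr0, add0r, addrA).
  apply.
  + by move=> [|[|n]] // _; [exact: cuts_proj_line cm|exact: cuts_proj_line cn].
  + by move=> [|[|n]].
  + by move=> [|[|[|[|[|[|n]]]]]] [|[|[|[|[|[|n'']]]]]].
Qed.
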